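(* Let $r\ge2$ be an integer. There exists a unique formal series $$|\widetilde I^{(r-1/2)}\rangle=\Lambda_{2r-1}^{\nu}\exp\left(\sum_{j=1}^{r-1}\frac{g_j(c_0,\ldots,c_{r-1})}{\Lambda_{2r-1}^j}\right)\sum_{k=0}^\infty\Lambda_{2r-1}^kv_k$$ (that is, unique $\nu,g_1,\ldots,g_{r-1}\in\mathcal A$ and unique descendants $v_k\in M_{\mathcal A}$, $k\ge1$, of $v_0$) satisfying $$L_*|\widetilde I^{(r-1/2)}\rangle=\Lambda_{2r-1}^r\frac{\partial}{\partial\Lambda_{2r-1}}|\widetilde I^{(r-1/2)}\rangle,\qquad L_n|\widetilde I^{(r-1/2)}\rangle=\Lambda_n|\widetilde I^{(r-1/2)}\rangle\quad(n=r,r+1,\ldots,2r-1),$$ where $v_0=|I^{(r-1)}\rangle$ is the irregular vector of rank $r-1$ such that $L_nv_0=\Lambda'_nv_0$ for $n=r-1,r,\ldots,2r-2$.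
   Context: Virasoro algebra: $\mathrm{Vir}=\bigoplus_{n\in\mathbb Z}\mathbb C L_n\oplus\mathbb C\mathbf c$, $[L_m,L_n]=(m-n)L_{m+n}+\frac{\mathbf c}{12}(m^3-m)\delta_{m+n,0}$, with $\mathbf c$ acting by $1+6Q^2$. $Q,c_0,c_1,\ldots,c_{r-1},\Lambda_{2r-1}$ are independent parameters; $c_a=0$ for $a<0$ or $a>r-1$. Weights: $\Lambda_n=-\sum_{p+q=n,\,1\le p,q\le r-1}c_pc_q$ for $r\le n\le 2r-2$; $\Lambda_{2r-1}$ is the independent parameter; $\Lambda_n=0$ for $n>2r-1$. $\Lambda'_n=\delta_{n,r-1}((n+1)Q-2c_0)c_{r-1}-\sum_{p+q=n,\,1\le p,q\le r-1}c_pc_q$ for $n\ge r-1$ (so $\Lambda'_n=0$ for $n>2r-2$). Coefficient ring: $\mathcal A=\mathbb C(Q,c_0)[c_1,\ldots,c_{r-1},c_{r-1}^{-1}]$. $M_{\mathcal A}$ is the rank $r-1$ irregular Verma module over $\mathcal A$: the $\mathrm{Vir}$-module induced from the subalgebra generated by $L_n$ ($n\ge r-1$) and $\mathbf c$ acting on $\mathcal Av_0$ by $L_nv_0=\Lambda'_nv_0$ $(n\ge r-1)$; PBW basis $L_{-\lambda_1+r-1}\cdots L_{-\lambda_\ell+r-1}v_0$ over partitions $\lambda$. Descendants of $v_0$ are elements of $M_{\mathcal A}$. Formal exponential sector: $P=\Lambda_{2r-1}^\nu\exp(\sum_jg_j/\Lambda_{2r-1}^j)$ is a formal prefactor; $\mathrm{Vir}$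 acts on the coefficients $v_k$, and with $t=\Lambda_{2r-1}$, $\partial_t(PF)=P\bigl(\partial_tF+(\nu/t-\sum_jjg_j/t^{j+1})F\bigr)$ for $F=\sum_kt^kv_k$ (the $v_k$ do not depend on $t$). Vector fields: $\mathcal V_0=\sum_{k=1}^{r-1}kc_k\partial_{c_k}+(2r-1)\Lambda_{2r-1}\partial_{\Lambda_{2r-1}}$, and for $1\le n\le r-1$, $\mathcal V_n=\sum_{k=1}^{r-n}h_{n,k}\partial_{c_k}$ is the unique rational vector field of this form in the variables $(c_1,\ldots,c_{r-1},\Lambda_{2r-1})$ with $\mathcal V_n(\Lambda_m)=(m-n)\Lambda_{m+n}$ for $r\le m\le 2r-1$. Canonical operator: let $\mathcal M$ be the $r\times r$ matrix defined by $(\mathcal V_0,\ldots,\mathcal V_{r-1})^{\mathsf T}=\mathcal M\,(\partial_{c_1},\ldots,\partial_{c_{r-1}},\partial_{\Lambda_{2r-1}})^{\mathsf T}$; it is invertible where $c_{r-1}\Lambda_{2r-1}\ne0$, with $\det\mathcal M=\kappa\Lambda_{2r-1}^r/c_{r-1}^{r-1}$, $\kappa$ a non-zero constant. Put $L_*=\Lambda_{2r-1}^r\sum_{m=0}^{r-1}(\mathcal M^{-1})_{r,m+1}L_m$, which is polynomial in $\Lambda_{2r-1}$ with coefficients linear combinations of $L_0,\ldots,L_{r-1}$ over $\mathbb C[c_1,\ldots,c_{r-1},c_{r-1}^{-1}]$. *)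

(* Defs.v *)
From HB Require Import structures.
From mathcomp Require Import all_boot all_order all_algebra perm.
From mathcomp Require Import boolp classical_sets reals complex.
From mathcomp Require Import ssrcomplements freeg mpoly zify ring.
Set Implicit Arguments.
Unset Strict Implicit.
Unset Printing Implicit Defensive.
Import Order.TTheory GRing.Theory Num.Theory.
Local Open Scope ring_scope.

Section Coefficients.
Variables (C : numFieldType) (r : nat).

(* C(Q, c_0) *)
Definition baseF : fieldType := {fraction {mpoly C[2]}}.
Definition parQ : baseF := tofrac 'X_ord0.
Definition parc0 : baseF := tofrac 'X_ord_max.

(* C(Q, c_0)[c_1, ..., c_(r-1)]; the variable 'X_i stands for c_(i+1). *)
Definition cpoly : idomainType := {mpoly baseF[r.-1]}.

(* c_a, with c_a = 0 for a > r - 1. *)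
Definition cvar (a : nat) : cpoly :=
  if a is a'.+1 then oapp (fun i : 'I_r.-1 => 'X_i : cpoly) 0 (insub a')
  else (parc0%:MP : cpoly).

(* Rational functions in c_1, ..., c_(r-1) and t = Lambda_(2r-1) over
   C(Q, c_0); t is the indeterminate 'X of {poly cpoly}. *)
Definition ratF : fieldType := {fraction {poly cpoly}}.

Definition quadc (n : nat) : cpoly :=
  \sum_(1 <= p < r) \sum_(1 <= q < r | (p + q == n)%N) cvar p * cvar q.

(* Lambda_n for n >= r; it vanishes for n > 2r - 1, the sum being empty. *)
Definition Lambda (n : nat) : {poly cpoly} :=
  if n == (2 * r).-1 then 'X else (- quadc n)%:P.

(* Lambda'_n for n >= r - 1 *)
Definition Lambda' (n : nat) : cpoly :=
  (n == r.-1)%:R * (n.+1%:R * parQ - 2 * parc0)%:MP * cvar r.-1 - quadc n.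

(* A vector field is the row of its coefficients: column j < r - 1 is the
   coefficient of d/dc_(j+1), the last column that of d/dt. *)
Definition partial (j : 'I_r.-1.+1) (f : {poly cpoly}) : {poly cpoly} :=
  if unlift ord_max j is Some i then map_poly (@mderiv r.-1 baseF i) f
  else f^`().

Definition vf_act (h : 'rV[ratF]_r.-1.+1) (f : {poly cpoly}) : ratF :=
  \sum_j h 0 j * tofrac (partial j f).

Definition eulerV : 'rV[ratF]_r.-1.+1 :=
  \row_j if unlift ord_max j is Some i then i.+1%:R * tofrac (cvar i.+1)%:P
         else (2 * r).-1%:R * tofrac 'X.

(* The first condition restricts h to d/dc_1, ..., d/dc_(r-n). *)
Definition is_vfield (n : nat) (h : 'rV[ratF]_r.-1.+1) : Prop :=
  (forall j : 'I_r.-1.+1, (r - n <= j)%N -> h 0 j = 0) /\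
  (forall m, (r <= m <= (2 * r).-1)%N ->
     vf_act h (Lambda m) = (m - n)%:R * tofrac (Lambda (m + n))).

(* Existence and uniqueness: is_vfield_vfield and is_vfield_inj below. *)
Definition vfield (n : nat) : 'rV[ratF]_r.-1.+1 :=
  if n == 0%N then eulerV else xget 0 [set h | is_vfield n h]%classic.

(* Invertible for r >= 2: see calM_unit. *)
Definition calM : 'M[ratF]_r.-1.+1 := \matrix_(n, j) vfield n 0 j.

(* The subring A = C(Q, c_0)[c_1, ..., c_(r-1), 1/c_(r-1)] of ratF *)
Definition in_coefA : {pred ratF} := fun x =>
  `[< exists p : cpoly, exists k : nat,
        x = tofrac p%:P / tofrac (cvar r.-1)%:P ^+ k >].

Lemma cvarE (i : 'I_r.-1) : cvar i.+1 = 'X_i.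
Proof. by rewrite /cvar valK. Qed.

Lemma c_last_neq0 : cvar r.-1 != 0.
Proof.
have [r0|rgt0] := posnP r.-1.
  have -> : cvar r.-1 = parc0%:MP by rewrite (congr1 cvar r0).
  by rewrite mpolyC_eq0 tofrac_eq0 -msize_poly_eq0 msizeX mdeg1.
have lt_r2 : (r.-2 < r.-1)%N by rewrite -[in ltnRHS](prednK rgt0).
have -> : r.-1 = (Ordinal lt_r2).+1 by rewrite /= (prednK rgt0).
by rewrite cvarE -msize_poly_eq0 msizeX mdeg1.
Qed.

Lemma cF_neq0 : tofrac (cvar r.-1)%:P != 0 :> ratF.
Proof. by rewrite tofrac_eq0 polyC_eq0 c_last_neq0. Qed.

Lemma coefA_subring : subring_closed in_coefA.
Proof.
have u k : tofrac (cvar r.-1)%:P ^+ k != 0 :> ratF.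
  by rewrite expf_neq0 ?cF_neq0.
split=> [|x y|x y].
- by apply/asboolP; exists 1, 0%N; rewrite expr0 divr1 tofrac1.
- move=> /asboolP[p [k ->]] /asboolP[q [l ->]]; apply/asboolP.
  exists (p * cvar r.-1 ^+ l - q * cvar r.-1 ^+ k), (k + l)%N.
  rewrite -mulNr addf_div // exprD rmorphB !rmorphM !rmorphXn /=.
  by rewrite rmorphB !rmorphM !rmorphXn /= mulNr.
- move=> /asboolP[p [k ->]] /asboolP[q [l ->]]; apply/asboolP.
  by exists (p * q), (k + l)%N; rewrite exprD !rmorphM mulf_div.
Qed.

HB.instance Definition _ := GRing.isSubringClosed.Build ratF in_coefA
  coefA_subring.

Record coefA := CoefA { coefA_val : ratF; _ : coefA_val \in in_coefA }.
HB.instance Definition _ := [isSub for coefA_val].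
HB.instance Definition _ := [Choice of coefA by <:].
HB.instance Definition _ := [SubChoice_isSubComNzRing of coefA by <:].

Lemma polyA_subproof (p : cpoly) : tofrac p%:P \in in_coefA.
Proof. by apply/asboolP; exists p, 0%N; rewrite expr0 divr1. Qed.

(* The inclusion of C(Q, c_0)[c_1, ..., c_(r-1)] in A *)
Definition polyA (p : cpoly) : coefA := CoefA (polyA_subproof p).

Definition cstA (x : baseF) : coefA := polyA x%:MP.

Definition LambdaA (n : nat) : {poly coefA} := map_poly polyA (Lambda n).

(* Value in ratF of an element of A[t] *)
Definition evalA (a : {poly coefA}) : ratF :=
  (map_poly (val : coefA -> ratF) a).[tofrac 'X].

(* The coefficient t^r (M^-1)_(r, m+1) of L_m in L_*, as the element of A[t]
   that it is; existence and uniqueness: evalA_Lstar_coef and evalA_inj. *)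
Definition Lstar_coef (m : 'I_r.-1.+1) : {poly coefA} :=
  xget 0 [set a | evalA a = tofrac 'X ^+ r * invmx calM ord_max m]%classic.

End Coefficients.

Lemma common_denominator (A B : comNzRingType) (F : fieldType)
    (iota : {rmorphism A -> F}) (phi : {rmorphism B -> F}) (d : B) :
  (forall x, exists q l, iota x * phi d ^+ l = phi q) ->
  forall a : {poly A}, exists k p,
    map_poly iota a * (phi d ^+ k)%:P = map_poly phi p.
Proof.
move=> H; elim/poly_ind => [|a x [k [p IH]]].
  by exists 0%N, 0; rewrite !map_poly0 mul0r.
have [q [l hq]] := H x.
exists (k + l)%N, (p * (d ^+ l)%:P * 'X + (q * d ^+ k)%:P).
have -> : map_poly phi (p * (d ^+ l)%:P * 'X + (q * d ^+ k)%:P) =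
    map_poly phi p * (phi d ^+ l)%:P * 'X + (phi q * phi d ^+ k)%:P.
  by rewrite rmorphD !rmorphM /= !map_polyC map_polyX /= ?rmorphM /= ?rmorphXn.
have -> : map_poly iota (a * 'X + x%:P) = map_poly iota a * 'X + (iota x)%:P.
  by rewrite rmorphD rmorphM /= map_polyC map_polyX.
by rewrite -IH -hq exprD !polyCM; ring.
Qed.

Section RMorphisms.
Variables (C : numFieldType) (r : nat).

Lemma polyA_is_zmod_morphism : zmod_morphism (@polyA C r).
Proof.
by move=> p q; apply: val_inj; rewrite [LHS]/= polyCB tofracB.
Qed.

Lemma polyA_is_monoid_morphism : monoid_morphism (@polyA C r).
Proof.
by split=> [|p q]; apply: val_inj; rewrite [LHS]/= ?polyCM ?tofracM.
Qed.

HB.instance Definition _ :=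
  GRing.isZmodMorphism.Build _ _ (@polyA C r) polyA_is_zmod_morphism.
HB.instance Definition _ :=
  GRing.isMonoidMorphism.Build _ _ (@polyA C r) polyA_is_monoid_morphism.

HB.instance Definition _ := GRing.RMorphism.copy (@evalA C r)
  (horner_eval (tofrac 'X) \o map_poly (val : coefA C r -> ratF C r)).

End RMorphisms.

Section WellDefined.
Variables (C : numFieldType) (r : nat).
Hypothesis hr : (2 <= r)%N.
Local Notation c := (cvar C r).
Local Notation B := {mpoly (baseF C)[r.-1]}.
Local Notation F := (ratF C r).
Local Notation Lam := (Lambda C r).

Lemma natF_eq0 n : (n%:R == 0 :> F) = (n == 0%N).
Proof.
have -> : n%:R = tofrac (tofrac (n%:R : C)%:MP)%:MP%:P :> F.
  by rewrite !rmorph_nat.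
by rewrite tofrac_eq0 polyC_eq0 mpolyC_eq0 tofrac_eq0 mpolyC_eq0 pnatr_eq0.
Qed.

Lemma mderiv_c (i : 'I_r.-1) p :
  (0 < p)%N -> (c p : B)^`M(i) = (p == i.+1)%:R.
Proof.
case: p => // p _; rewrite eqSS; have [lt|ge] := ltnP p r.-1.
  pose j := Ordinal lt; rewrite -[p]/(val j) cvarE mderivX mnm1E val_eqE.
  have [->|_] := eqVneq j i; last by rewrite scale0r.
  by rewrite scale1r (_ : (_ - _)%MM = 0%MM) ?mpolyX0 //; apply/mnmP => k;
    rewrite mnmBE mnm0E subnn.
have -> : c p.+1 = 0 by rewrite /cvar insubF // ltnNge ge.
have -> : (p == i) = false by apply: contraTF ge => /eqP->; rewrite -ltnNge.
exact: mderiv0.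
Qed.

Lemma mderiv_quadc (i : 'I_r.-1) n :
  (quadc C r n : B)^`M(i) = (\sum_(1 <= q < r | (i.+1 + q == n)%N) c q) *+ 2.
Proof.
have iin : i.+1 \in index_iota 1 r.
  by rewrite mem_index_iota /= -[ltnRHS](prednK (ltnW hr)) ltnS.
pose f p q : B := if (p + q == n)%N then (c p : B)^`M(i) * c q else 0.
have -> : (quadc C r n : B)^`M(i) =
    \sum_(1 <= p < r) \sum_(1 <= q < r) (f p q + f q p).
  rewrite /quadc raddf_sum; apply: eq_bigr => p _.
  rewrite raddf_sum big_mkcond; apply: eq_bigr => q _.
  rewrite /f (addnC q p); case: eqP => _; last by rewrite addr0.
  by rewrite /= mderivM [X in _ + X]mulrC.
under eq_bigr do rewrite big_split /=.
rewrite big_split /= [X in _ + X]exchange_big /= -mulr2n; congr (_ *+ 2).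
pose S : B := \sum_(1 <= q < r | (i.+1 + q == n)%N) c q.
have hf p : p \in index_iota 1 r ->
    \sum_(1 <= q < r) f p q = if p == i.+1 then S else 0.
  rewrite mem_index_iota => /andP[p0 _]; rewrite /f mderiv_c //.
  have [->|_] := eqVneq p i.+1.
    rewrite /S [in RHS]big_mkcond; apply: eq_bigr => q _.
    by rewrite (_ : true%:R = 1 :> B) ?mul1r.
  rewrite big1 // => q _; rewrite (_ : false%:R = 0 :> B) ?mul0r //.
  by case: ifP.
rewrite (eq_big_seq _ hf) (bigD1_seq _ iin (iota_uniq _ _)) eqxx.
by rewrite big1 => [|p /negPf->//]; exact: addr0.
Qed.

Lemma euler_quadc n :
  \sum_(i < r.-1) (i.+1%:R * c i.+1) * (quadc C r n : B)^`M(i) =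
  n%:R * quadc C r n.
Proof.
pose f p q : B := if (p + q == n)%N then p%:R * (c p * c q) else 0.
have -> : n%:R * quadc C r n =
    \sum_(1 <= p < r) \sum_(1 <= q < r) (f p q + f q p).
  rewrite /quadc big_distrr; apply: eq_bigr => p _.
  rewrite big_distrr big_mkcond; apply: eq_bigr => q _.
  rewrite /f (addnC q p); case: eqP => [<-|_]; last by rewrite addr0.
  by rewrite (mulrC (c q)) -mulrDl -natrD.
under [RHS]eq_bigr do rewrite big_split /=.
rewrite big_split /= [X in _ = _ + X]exchange_big /= -mulr2n.
rewrite big_add1 big_mkord -sumrMnl; apply: eq_bigr => i _.
rewrite mderiv_quadc mulrnAr; congr (_ *+ 2).
rewrite mulr_sumr big_mkcond; apply: eq_bigr => q _.
by rewrite /f; case: eqP => // _; rewrite mulrA.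
Qed.

Lemma vf_actE (h : 'rV[F]_r.-1.+1) f :
  vf_act h f =
    \sum_(i < r.-1) h 0 (fintype.lift ord_max i) *
      tofrac (map_poly (@mderiv r.-1 (baseF C) i) f) +
    h 0 ord_max * tofrac f^`().
Proof.
rewrite /vf_act big_ord_recr /partial unlift_none; congr (_ + _).
apply: eq_bigr => i _.
have -> : widen_ord (leqnSn r.-1) i = fintype.lift ord_max i.
  by apply: ord_inj; rewrite lift_max.
by rewrite liftK.
Qed.

Lemma mderiv_polyX (i : 'I_r.-1) :
  map_poly (@mderiv r.-1 (baseF C) i) 'X = 0.
Proof.
apply/polyP => k; rewrite coef_map coefX coef0.
by rewrite -(rmorph_nat (@mpolyC r.-1 (baseF C))) [LHS]mderivC.
Qed.

Lemma LamX : Lam (2 * r).-1 = 'X.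
Proof. by rewrite /Lambda eqxx. Qed.

Lemma LamC m : m != (2 * r).-1 -> Lam m = (- quadc C r m)%:P.
Proof. by rewrite /Lambda => /negPf->. Qed.

Lemma mderiv_Lam (i : 'I_r.-1) m : m != (2 * r).-1 ->
  map_poly (@mderiv r.-1 (baseF C) i) (Lam m) =
  (- (quadc C r m : B)^`M(i))%:P.
Proof. by move=> /LamC->; rewrite map_polyC; congr (_%:P); apply: mderivN. Qed.

Lemma Lam_eq0 m : (2 * r - 1 < m)%N -> Lam m = 0.
Proof.
move=> hm; rewrite LamC; last by apply/eqP; lia.
rewrite /quadc big_nat big1 ?oppr0 // => p hp.
by rewrite big_nat_cond big1 // => q /andP[hq /eqP hpq]; lia.
Qed.

Lemma natF_mul n (p : cpoly C r) :
  n%:R * tofrac p%:P = tofrac (n%:R * p)%:P :> F.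
Proof. by rewrite polyCM tofracM !rmorph_nat. Qed.

Lemma vf_act_euler m : vf_act (eulerV C r) (Lam m) = m%:R * tofrac (Lam m).
Proof.
rewrite vf_actE /eulerV !mxE unlift_none.
have [->|ne] := eqVneq m (2 * r).-1.
  rewrite LamX derivX tofrac1 mulr1 big1 ?add0r // => i _.
  by rewrite mderiv_polyX tofrac0 mulr0.
rewrite [X in _ + _ * tofrac X](_ : _ = 0); last by rewrite LamC ?derivC.
have e : m%:R * - quadc C r m =
    \sum_(i < r.-1) (i.+1%:R * c i.+1) * - (quadc C r m : B)^`M(i).
  by rewrite mulrN -euler_quadc (big_morph _ (@opprD _) (@oppr0 _));
    apply: eq_bigr => i _; rewrite mulrN.
rewrite tofrac0 mulr0 addr0 LamC // natF_mul e.
rewrite [RHS](_ : _ = \sum_(i < r.-1) tofrac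
    ((i.+1%:R * c i.+1) * - (quadc C r m : B)^`M(i))%:P); last first.
  by rewrite !rmorph_sum.
apply: eq_bigr => i _.
rewrite mxE liftK map_polyC natF_mul -tofracM -polyCM.
by congr (tofrac (_ * _)%:P); apply: mderivN.
Qed.

(* The Jacobian matrix of (Lambda_r, ..., Lambda_(2r-1)) with respect to
   (c_1, ..., c_(r-1), t); calM *m jacM = brackM has entries
   V_n(Lambda_m) = (m - n) Lambda_(m+n). *)
Definition jacM : 'M[F]_r.-1.+1 :=
  \matrix_(j, m) tofrac (partial j (Lam (r + m))).

Lemma vf_act_jac h (m : 'I_r.-1.+1) :
  vf_act h (Lam (r + m)) = (h *m jacM) 0 m.
Proof. by rewrite mxE; apply: eq_bigr => j _; rewrite mxE. Qed.

Lemma jac_trig : is_trig_mx jacM.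
Proof.
apply/is_trig_mxP => j m lt; rewrite mxE /partial.
case: unliftP lt => [i ->|->]; last by rewrite ltnNge -ltnS ltn_ord.
rewrite lift_max => lt.
have [e|ne] := eqVneq (r + m)%N (2 * r).-1.
  by rewrite e LamX mderiv_polyX tofrac0.
rewrite (mderiv_Lam _ ne) mderiv_quadc [X in X *+ 2](_ : _ = 0).
  by rewrite mul0rn oppr0 polyC0 tofrac0.
rewrite big_nat_cond; apply: big1 => q /andP[hq /eqP e].
by have := ltn_ord m; lia.
Qed.

Lemma jac_diag (m : 'I_r.-1.+1) : jacM m m != 0.
Proof.
rewrite mxE /partial; case: unliftP => [i em|->].
  rewrite em lift_max mderiv_Lam; last first.
    move: (ltn_ord i : (i < r.-1)%N); move: (nat_of_ord i) => k lt.
    by apply/eqP; lia.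
  rewrite mderiv_quadc [X in X *+ 2](_ : _ = c r.-1).
    rewrite tofrac_eq0 polyC_eq0 oppr_eq0 -mulr_natr mulf_eq0.
    rewrite (negPf (c_last_neq0 _ _)) /=.
    have := natF_eq0 2; rewrite -(rmorph_nat (@tofrac {poly cpoly C r})).
    by rewrite tofrac_eq0 -(rmorph_nat (@polyC (cpoly C r))) polyC_eq0 => ->.
  have rin : r.-1 \in index_iota 1 r by rewrite mem_index_iota; lia.
  move: (ltn_ord i : (i < r.-1)%N); move: (nat_of_ord i) => k lt.
  rewrite big_mkcond.
  rewrite (bigD1_seq _ rin (iota_uniq _ _)) (_ : (_ == _)%N); last first.
    by apply/eqP; lia.
  rewrite big_nat_cond big1 => [|q /andP[hq ne]]; first exact: addr0.
  by rewrite (_ : (_ == _)%N = false) //; apply/eqP; move/eqP: ne; lia.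
rewrite (_ : (r + _)%N = (2 * r).-1) /=; last by lia.
by rewrite LamX derivX tofrac1 oner_neq0.
Qed.

Lemma jac_unit : jacM \in unitmx.
Proof.
rewrite unitmxE (det_trig jac_trig) unitfE.
by apply/prodf_neq0 => i _; apply: jac_diag.
Qed.

Definition brackM : 'M[F]_r.-1.+1 :=
  \matrix_(n, m) ((r + m - n)%N%:R * tofrac (Lam (r + m + n))).

Lemma is_vfieldP (n : 'I_r.-1.+1) h : (0 < n)%N ->
  is_vfield n h <-> h *m jacM = row n brackM.
Proof.
move=> n0; have nr : (n < r)%N by have := ltn_ord n; lia.
split=> [[_ hm]|e].
  apply/rowP => m; rewrite -vf_act_jac hm ?mxE //.
  by have := ltn_ord m; lia.
have em (m : 'I_r.-1.+1) : (h *m jacM) 0 m =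
    (r + m - n)%N%:R * tofrac (Lam (r + m + n)) by rewrite e !mxE.
split=> [j|m hm].
  have [k] := ubnP (r - j)%N; elim: k j => // k IHk j hk hj.
  have := em j; rewrite Lam_eq0 ?tofrac0 ?mulr0; last by lia.
  rewrite mxE (bigD1 j) //= big1 ?addr0 => [/eqP|l lj].
    by rewrite mulf_eq0 (negPf (jac_diag j)) orbF => /eqP.
  have [lt|ge] := ltnP l j.
    by rewrite (is_trig_mxP jac_trig) ?mulr0.
  rewrite IHk ?mul0r //; last exact: leq_trans ge.
  have : (j < l)%N by rewrite ltn_neqAle ge andbT eq_sym.
  by have := ltn_ord j; have := ltn_ord l; lia.
have lt : (m - r < r.-1.+1)%N by lia.
by have := em (Ordinal lt); rewrite -vf_act_jac /= subnKC //; case/andP: hm.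
Qed.

Lemma is_vfield_inj (n : 'I_r.-1.+1) (h h' : 'rV[F]_r.-1.+1) : (0 < n)%N ->
  is_vfield n h -> is_vfield n h' -> h = h'.
Proof.
move=> n0 /(is_vfieldP _ n0) e /(is_vfieldP _ n0) e'.
by rewrite -(mulmxK jac_unit h) e -e' mulmxK ?jac_unit.
Qed.

Lemma is_vfield_vfield (n : 'I_r.-1.+1) : (0 < n)%N ->
  is_vfield n (vfield C r n).
Proof.
move=> n0; rewrite /vfield gtn_eqF //.
have : is_vfield n (row n brackM *m invmx jacM).
  by apply/(is_vfieldP _ n0); rewrite mulmxKV ?jac_unit.
move=> ex; apply: (@xgetPex _ 0 [set h | is_vfield n h]%classic).
by exists (row n brackM *m invmx jacM).
Qed.

Lemma calM_jac : calM C r *m jacM = brackM.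
Proof.
apply/row_matrixP => n; rewrite row_mul.
have -> : row n (calM C r) = vfield C r n.
  by apply/rowP => j; rewrite !mxE.
have [n0|] := posnP n; last first.
  by move=> n0; apply/(is_vfieldP _ n0)/is_vfield_vfield.
apply/rowP => m; rewrite -vf_act_jac /vfield n0 vf_act_euler !mxE.
by rewrite n0 subn0 addn0.
Qed.

Lemma ratF_of_poly (p : {poly cpoly C r}) :
  (map_poly (fun x : cpoly C r => tofrac x%:P : F) p).[tofrac 'X] = tofrac p.
Proof.
rewrite (map_poly_comp (@tofrac _) polyC) horner_map; congr tofrac.
exact: comp_polyXr.
Qed.

Lemma evalA_LamA n : evalA (LambdaA C r n) = tofrac (Lam n).
Proof.
rewrite -ratF_of_poly /evalA /LambdaA -map_poly_comp_id0 //.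
Qed.

Lemma LamAX : LambdaA C r (2 * r).-1 = 'X.
Proof. by rewrite /LambdaA LamX map_polyX. Qed.

Lemma LamA_eq0 n : (2 * r - 1 < n)%N -> LambdaA C r n = 0.
Proof. by move=> hn; rewrite /LambdaA Lam_eq0 ?rmorph0. Qed.

Definition brackA : 'M[{poly coefA C r}]_r.-1.+1 :=
  \matrix_(n, m) ((r + m - n)%N%:R * LambdaA C r (r + m + n)).

Lemma map_brackA : map_mx (@evalA C r) brackA = brackM.
Proof.
apply/matrixP => n m; rewrite !mxE rmorphM rmorph_nat.
by congr (_ * _); apply: evalA_LamA.
Qed.

Lemma det_brackA : exists2 x : baseF C, x != 0 &
  \det brackA = (cstA r x)%:P * 'X^r.
Proof.
pose s : {perm 'I_r.-1.+1} := perm rev_ord_inj.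
have sE m : s m = (r - m.+1)%N :> nat by rewrite permE /=; lia.
have tr : is_trig_mx (col_perm s brackA)^T.
  apply/is_trig_mxP => m n lt; rewrite !mxE LamA_eq0 ?mulr0 // sE.
  by have := ltn_ord n; lia.
pose N := (\prod_(n < r.-1.+1) (2 * (r - n.+1)).+1)%N.
have dN : \det (col_perm s brackA) = N%:R * 'X^r.
  rewrite -det_tr (det_trig tr) natr_prod.
  have -> : 'X^r = \prod_(n < r.-1.+1) 'X :> {poly coefA C r}.
    by rewrite prodr_const card_ord prednK // ltnW.
  rewrite -big_split /=; apply: eq_bigr => n _; rewrite !mxE sE -LamAX.
  by congr (_%:R * LambdaA _ _ _); have := ltn_ord n; lia.
have N0 : (N%:R : baseF C) != 0.
  have -> : (N%:R : baseF C) = tofrac (N%:R : C)%:MP by rewrite !rmorph_nat.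
  by rewrite tofrac_eq0 mpolyC_eq0 pnatr_eq0 -lt0n prodn_gt0.
exists ((-1) ^+ s * N%:R).
  by rewrite mulf_eq0 signr_eq0 negb_or N0.
have -> : (cstA r ((-1) ^+ s * N%:R))%:P = (-1) ^+ s * N%:R :> {poly coefA C r}.
  by rewrite /cstA !rmorphM !rmorph_sign !rmorph_nat.
rewrite -mulrA -dN col_permE det_mulmx det_perm odd_permV.
by rewrite mulrCA -signr_addb addbb mulr1.
Qed.

Lemma evalAM (a b : {poly coefA C r}) : evalA (a * b) = evalA a * evalA b.
Proof. exact: rmorphM. Qed.

Lemma evalA_cst (x : baseF C) : evalA (cstA r x)%:P = tofrac (x%:MP)%:P.
Proof. by rewrite /evalA map_polyC hornerC. Qed.

Lemma evalAXn n : evalA 'X^n = tofrac 'X ^+ n :> F.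
Proof. by rewrite /evalA map_polyXn hornerXn. Qed.

Lemma det_brackM x : \det brackA = (cstA r x)%:P * 'X^r ->
  \det brackM = tofrac (x%:MP)%:P * tofrac 'X ^+ r :> F.
Proof.
move=> e; rewrite -map_brackA det_map_mx e [LHS]evalAM.
by rewrite evalA_cst evalAXn.
Qed.

Lemma brackM_unit : brackM \in unitmx.
Proof.
have [x x0 /det_brackM e] := det_brackA; rewrite unitmxE e unitfE.
by rewrite mulf_neq0 ?expf_neq0 ?tofrac_eq0 ?polyC_eq0 ?mpolyC_eq0 ?polyX_eq0.
Qed.

Lemma calM_unit : calM C r \in unitmx.
Proof.
have : calM C r *m jacM \in unitmx by rewrite calM_jac brackM_unit.
rewrite (unitmx_mul (calM C r) jacM) => /andP[h _]; exact: h.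
Qed.

Lemma invmx_calM_last m : invmx (calM C r) ord_max m = invmx brackM ord_max m.
Proof.
have -> : invmx (calM C r) = jacM *m invmx brackM.
  by rewrite -[in RHS](mulKmx calM_unit jacM) calM_jac mulmxK ?brackM_unit.
rewrite mxE (bigD1 ord_max) // big1 => [|j ne]; rewrite /= !mxE.
  rewrite addr0 (_ : (r + _)%N = (2 * r).-1) /=; last by lia.
  by rewrite LamX /partial unlift_none derivX tofrac1 mul1r.
rewrite /partial unlift_none LamC; first by rewrite derivC tofrac0 mul0r.
move: ne (ltn_ord j); rewrite -val_eqE /=; move: (nat_of_ord j) => k.
by move=> /eqP ne lt; apply/eqP; lia.
Qed.

Lemma evalA_Lstar_coef m :
  evalA (Lstar_coef C m) = tofrac 'X ^+ r * invmx (calM C r) ord_max m.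
Proof.
apply: (@xgetPex _ 0
  [set a | evalA a = tofrac 'X ^+ r * invmx (calM C r) ord_max m]%classic).
have [x x0 e] := det_brackA.
exists ((cstA r x^-1)%:P * (\adj brackA) ord_max m) => /=.
have xF : tofrac (x%:MP)%:P != 0 :> F.
  by rewrite tofrac_eq0 polyC_eq0 mpolyC_eq0.
have t0 : tofrac 'X ^+ r != 0 :> F by rewrite expf_neq0 ?tofrac_eq0 ?polyX_eq0.
have xV : tofrac (x^-1%:MP)%:P = (tofrac (x%:MP)%:P)^-1 :> F.
  apply: (mulfI xF); rewrite (divff xF) -tofracM -polyCM -mpolyCM (divff x0).
  by rewrite mpolyC1 polyC1 tofrac1.
have aE : evalA (\adj brackA ord_max m) = \adj brackM ord_max m.
  by rewrite -map_brackA -map_mx_adj [RHS]mxE.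
rewrite invmx_calM_last evalAM evalA_cst aE xV /invmx brackM_unit.
rewrite [X in _ = _ * X]mxE.
rewrite (det_brackM e).
rewrite invfM; move: (\adj brackM ord_max m) => y.
by rewrite [_ * _ * y]mulrAC [RHS]mulrC mulfVK.
Qed.

Lemma evalA_inj : injective (@evalA C r).
Proof.
suff h a : evalA a = 0 :> F -> a = 0.
  move=> a b e; apply/eqP; rewrite -subr_eq0; apply/eqP/h.
  by rewrite /evalA rmorphB hornerD hornerN -/(evalA a) e subrr.
move=> a0.
pose phi : {rmorphism cpoly C r -> F} := @tofrac {poly cpoly C r} \o @polyC _.
pose iota : {rmorphism coefA C r -> F} := (val : coefA C r -> F).
have u k : phi (c r.-1) ^+ k != 0 :> F by rewrite expf_neq0 ?cF_neq0.
have [x|k [p e]] := @common_denominator _ _ _ iota phi (c r.-1) _ a.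
  have /asboolP[q [l hq]] := valP x.
  by exists q, l; rewrite [iota x]hq; apply: (mulfVK (u l)).
have p0 : p = 0.
  apply/eqP; rewrite -tofrac_eq0 -ratF_of_poly -[X in X.[_]]e.
  by rewrite hornerM [X in X * _]a0 mul0r.
move: e; rewrite p0 [RHS]rmorph0 => /eqP; rewrite mulf_eq0 polyC_eq0.
rewrite (negPf (u k)) orbF => /eqP e.
apply: (map_inj_poly (val_inj : injective iota) (rmorph0 _)).
by rewrite rmorph0.
Qed.

End WellDefined.

Section Modules.
Variables (C : numFieldType) (r : nat).
Local Notation A := (coefA C r).

(* Actions of the Virasoro algebra with c acting by 1 + 6 Q^2 *)
Definition is_vir (M : lmodType A) (L : int -> {linear M -> M}) : Prop :=
  forall (m n : int) (x : M),
    L m (L n x) - L n (L m x) =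
    (m - n)%:~R *: L (m + n) x +
    (if m + n == 0 then
       cstA r ((m ^+ 3 - m)%:~R / 12%:R * (1 + 6%:R * parQ C ^+ 2)) *: x
     else 0).

Definition is_whittaker (M : lmodType A) (L : int -> {linear M -> M}) (v : M) :
  Prop := forall n, (r.-1 <= n)%N -> L n%:Z v = polyA (Lambda' C r n) *: v.

Definition is_part (s : seq nat) : bool := sorted geq s && all (ltn 0) s.

Definition pbw (M : lmodType A) (L : int -> {linear M -> M}) (v : M)
    (s : seq nat) : M :=
  foldr (fun l x => L (r.-1%:Z - l%:Z) x) v s.

Record irregular_verma (M : lmodType A) (L : int -> {linear M -> M}) (v : M) :
    Prop := IrregularVerma {
  verma_vir : is_vir L;
  verma_whittaker : is_whittaker L v;
  (* M is induced from the character of the span of c and L_n, n >= r - 1 *)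
  verma_induced : forall (N : lmodType A) (K : int -> {linear N -> N}) (w : N),
    is_vir K -> is_whittaker K w ->
    exists2 phi : {linear M -> N},
      phi v = w /\ (forall n x, phi (L n x) = K n (phi x)) &
      forall psi : {linear M -> N},
        psi v = w -> (forall n x, psi (L n x) = K n (psi x)) -> psi =1 phi;
  verma_pbw_span : forall x : M, exists (S : seq (seq nat)) (a : seq nat -> A),
    all is_part S /\ x = \sum_(s <- S) a s *: pbw L v s;
  verma_pbw_free : forall (S : seq (seq nat)) (a : seq nat -> A),
    uniq S -> all is_part S -> \sum_(s <- S) a s *: pbw L v s = 0 ->
    forall s, s \in S -> a s = 0 }.

(* A formal series sum_k t^k v_k is the sequence of its coefficients. *)
Definition tmul (M : lmodType A) (a : {poly A}) (v : nat -> M) : nat -> M :=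
  fun N => \sum_(i < N.+1) a`_i *: v (N - i)%N.

Definition tderiv (M : lmodType A) (v : nat -> M) : nat -> M :=
  fun N => v N.+1 *+ N.+1.

Definition Lact (M : lmodType A) (L : int -> {linear M -> M}) (n : nat)
    (v : nat -> M) : nat -> M := fun N => L n%:Z (v N).

Definition Lstar (M : lmodType A) (L : int -> {linear M -> M})
    (v : nat -> M) : nat -> M :=
  fun N => \sum_(m < r.-1.+1) tmul (Lstar_coef C m) (Lact L m v) N.

(* t^r d/dt on P F, where P = t^nu exp (sum_j g_j / t^j), with P factored out;
   t^r (nu / t - sum_j j g_j / t^(j+1)) is a polynomial in t since j < r, and
   g i stands for g_(i+1). *)
Definition tr_ddt (M : lmodType A) (nu : A) (g : {ffun 'I_r.-1 -> A})
    (v : nat -> M) : nat -> M :=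
  fun N => tmul 'X^r (tderiv v) N +
    tmul (nu *: 'X^(r.-1) - \sum_(i < r.-1) (i.+1%:R * g i) *: 'X^(r - i.+2)) v
      N.

(* All sides below are coefficients of P. *)
Definition irregular_solution (M : lmodType A) (L : int -> {linear M -> M})
    (v0 : M) (nu : A) (g : {ffun 'I_r.-1 -> A}) (v : nat -> M) : Prop :=
  [/\ v 0%N = v0,
      Lstar L v =1 tr_ddt nu g v &
      forall n, (r <= n <= (2 * r).-1)%N ->
        Lact L n v =1 tmul (LambdaA C r n) v].

End Modules.

(* Main.v *)
Require Import Defs.
From mathcomp Require Import all_boot all_order all_algebra.
From mathcomp Require Import reals complex.
From HB Require Import structures.
From mathcomp Require Import boolp mpoly zify ssrAC.
Set Implicit Arguments.
Unset Strict Implicit.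
Unset Printing Implicit Defensive.
Import GRing.Theory Num.Theory.

(* Write rho = r - 1 and let chi be the character of the L_n, n >= rho, on v0.
   The operators S_j = L_(rho - j) - chi(rho - j), called [twL j] below, shift the
   weight filtration of the Verma module by j and satisfy
   [S_i, S_j] = (j - i) kappa delta_(i + j, 0) up to lower weight, where
   kappa = Lambda'_(2r-2) = - c_(r-1)^2 is a unit of A: to leading order they are
   the creation operators (j > 0) and annihilation operators (j < 0) of a Fock
   space. Hence sum_(j > 0) S_j S_(-j) acts on weight d as 2 d kappa, which gives
   H^0 = A v0 and H^1 = 0 for the algebra spanned by the L_n, n >= r. Therefore the
   series F in M[[t]] with L_n F = Lambda_n F for all n >= r form a free
   A[[t]]-module of rank one, generated by some w = v0 + O(t).
   By the definition of the vector fields, L_* - t^r d/dt preserves this module,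
   so (L_* - t^r d/dt) w = f w with f in A[[t]], and F = a w is a solution if and
   only if a f - t^r a' = G a, where G = t^r (nu / t - sum_j j g_j / t^(j+1)) is
   a polynomial of degree < r. With a(0) = 1 this forces G = f mod t^r and leaves
   a linear recursion for a. Finally, a solution in the sense of the theorem is
   also annihilated by L_n for n >= 2r: bracketing the L_* equation with L_(r+1)
   gives L_(2r), and the L_n with n > 2r are multiples of [L_r, L_(n-r)]. *)

(** * The weight filtration of the Verma module *)

Section Filtration.
Local Open Scope ring_scope.
Variables (A : comNzRingType) (M : lmodType A) (rho : nat).
Variables (L : int -> {linear M -> M}) (v0 : M) (chi z : int -> A).
Hypothesis rho_gt0 : (0 < rho)%N.
Hypothesis vir : forall m n x, L m (L n x) =
  L n (L m x) + (m - n)%:~R *: L (m + n) x +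
  (if m + n == 0 then z m *: x else 0).
Hypothesis chi_lt : forall n, n < rho%:Z -> chi n = 0.
Hypothesis chi_gt : forall n, (2 * rho)%N%:Z < n -> chi n = 0.
Hypothesis whittaker : forall n, rho%:Z <= n -> L n v0 = chi n *: v0.
Hypothesis natA_unit : forall n, (0 < n)%N -> exists y : A, y * n%:R = 1.
Local Notation kappa := (chi (2 * rho)%N%:Z).
Hypothesis kappa_unit : exists y : A, y * kappa = 1.

Definition twL (j : int) (x : M) : M := L (rho%:Z - j) x - chi (rho%:Z - j) *: x.

Fact twL_linear j : linear (twL j).
Proof.
move=> a x y; rewrite /twL linearP scalerDr scalerBr !scalerA [_ * a]mulrC.
by rewrite opprD addrACA.
Qed.
HB.instance Definition _ j :=
  GRing.isLinear.Build A M M _ (twL j) (twL_linear j).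

Definition word (s : seq nat) : M :=
  foldr (fun l x => L (rho%:Z - l%:Z) x) v0 s.

(** Words need not be ordered, so no PBW reordering ever enters. The index is an integer, so that
    lowering the degree below zero gives the zero submodule. *)
Inductive Fil : int -> M -> Prop :=
| Fil0 d : Fil d 0
| FilL d a x y : Fil d x -> Fil d y -> Fil d (a *: x + y)
| FilW d s : all (ltn 0) s -> (sumn s)%:Z <= d -> Fil d (word s).

Lemma FilD d x y : Fil d x -> Fil d y -> Fil d (x + y).
Proof. by move=> hx hy; rewrite -[x]scale1r; apply: FilL. Qed.

Lemma FilZ d a x : Fil d x -> Fil d (a *: x).
Proof. by move=> hx; rewrite -[_ *: _]addr0; apply: FilL => //; apply: Fil0. Qed.

Lemma Fil_sum d (I : Type) (s : seq I) (P : pred I) (f : I -> M) :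
  (forall i, P i -> Fil d (f i)) -> Fil d (\sum_(i <- s | P i) f i).
Proof.
move=> h; elim/big_rec: _ => [|i x Pi hx]; first exact: Fil0.
by apply: FilD => //; apply: h.
Qed.

Lemma Fil_le d e x : Fil d x -> d <= e -> Fil e x.
Proof.
elim=> [d' _|d' a x' y _ hx _ hy le|d' s ps le1 le2]; first exact: Fil0.
  by apply: FilL; [apply: hx | apply: hy].
by apply: FilW => //; apply: Order.POrderTheory.le_trans le2.
Qed.

Lemma Fil_lt0 d x : Fil d x -> d < 0 -> x = 0.
Proof.
elim=> [//|d' a x' y _ hx _ hy lt|d' s ps le1 le2]; last by lia.
by rewrite hx // hy // scaler0 addr0.
Qed.

Lemma Fil_0 d x : Fil d x -> d = 0 -> exists a, x = a *: v0.
Proof.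
elim=> [d' _|d' a x' y _ hx _ hy e|d' s ps le1 le2].
- by exists 0; rewrite scale0r.
- have [[b ->] [c ->]] := (hx e, hy e).
  by exists (a * b + c); rewrite scalerDl scalerA.
- exists 1; rewrite scale1r; case: s ps le1 => //= a s /andP[a0 _].
  by rewrite le2; lia.
Qed.

Lemma wordS a s : (0 < a)%N -> word (a :: s) = twL a%:Z (word s).
Proof. by move=> a0; rewrite /twL chi_lt ?scale0r ?subr0 //; lia. Qed.

(** The bracket gives [L] of index 2 rho - i - j, which is rewritten as a [twL] plus its scalar
    [chi]; the last term is the central one. *)
Lemma Scomm i j x : twL i (twL j x) = twL j (twL i x) +
  (j - i)%:~R *: (twL (i + j - rho%:Z) x + chi ((2 * rho)%N%:Z - i - j) *: x) +
  (if i + j == (2 * rho)%N%:Z then z (rho%:Z - i) *: x else 0).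
Proof.
rewrite {1 2 3 4 5}/twL.
have -> : rho%:Z - (i + j - rho%:Z) = (2 * rho)%N%:Z - i - j by lia.
rewrite subrK !scalerBr !(linearB (L _)) !(linearZZ (L _)) !scalerA vir.
have -> : rho%:Z - i - (rho%:Z - j) = j - i by lia.
have -> : rho%:Z - i + (rho%:Z - j) = (2 * rho)%N%:Z - i - j by lia.
have -> : ((2 * rho)%N%:Z - i - j == 0) = (i + j == (2 * rho)%N%:Z) by lia.
set c := if _ then _ else _.
move: (L _ (L _ x)) (_ *: L _ x) c => X Y c.
move: (L _ x) (L _ x) => U V.
rewrite [chi _ * chi _]mulrC !opprB.
by rewrite [LHS](AC (4*2) (1*6*(5*4)*2*3)).
Qed.


(** Commute [twL j] past the first letter a. The scalar terms respect the bound: [chi] of 2 rho - j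
    - a vanishes when j + a < 0, and the central term requires j + a = 2 rho. *)
Lemma word_deg j s : all (ltn 0) s -> Fil ((sumn s)%:Z + j) (twL j (word s)).
Proof.
have pos k d x : (0 < k)%N -> Fil d x -> Fil (d + k%:Z) (twL k%:Z x).
  move=> k0; elim=> [d'|d' a x' y _ hx _ hy|d' t pt le].
  - by rewrite linear0; apply: Fil0.
  - by rewrite linearP; apply: FilL.
  - rewrite -wordS //; apply: FilW; rewrite /= ?k0 //.
    by rewrite PoszD addrC lerD2r.
elim: s j => [|a s IHs] j /=.
  have [j0|j0] := lerP j 0.
    by rewrite /twL whittaker ?subrr; [move=> _; exact: Fil0|lia].
  by move=> _; have := @pos `|j|%N 0 v0; rewrite gtz0_abs // add0r; apply;
    [lia|exact: (@FilW 0 [::])].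
move=> /andP[a0 ps]; rewrite -[L _ _]/(word (a :: s)) wordS //.
have hy : Fil (sumn s)%:Z (word s) by apply: FilW.
rewrite Scomm; apply: FilD.
  apply: FilD.
    by apply: Fil_le (pos a _ _ a0 (IHs j ps)) _; lia.
  apply: FilZ; apply: FilD; first by apply: Fil_le (IHs _ ps) _; lia.
  have [le|lt] := lerP ((2 * rho)%N%:Z - j - a%:Z) (2 * rho)%N%:Z.
    by apply: FilZ; apply: Fil_le hy _; lia.
  by rewrite chi_gt // scale0r; exact: Fil0.
case: ifP => [/eqP e|_]; last exact: Fil0.
by apply: FilZ; apply: Fil_le hy _; lia.
Qed.

Lemma Fil_S j d x : Fil d x -> Fil (d + j) (twL j x).
Proof.
elim=> [d'|d' a x' y _ hx _ hy|d' s ps le].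
- by rewrite linear0; apply: Fil0.
- by rewrite linearP; apply: FilL.
- by apply: Fil_le (word_deg j ps) _; rewrite lerD2r.
Qed.

(** Heisenberg relation up to lower degree. The term in [twL (i + j - rho)] loses rho >= 1 degrees;
    the scalar vanishes for i + j < 0, equals kappa for i + j = 0, and for i + j > 0 leaves x in
    degree d, below d + i + j. *)
Lemma Fil_comm i j d x : Fil d x ->
  Fil (d + (i + j) - 1)
    (twL i (twL j x) - twL j (twL i x) -
     (if i + j == 0 then (j - i)%:~R * kappa else 0) *: x).
Proof.
move=> hx; rewrite Scomm.
have -> : forall X Y Z W : M, X + Y + Z - X - W = Y - W + Z.
  by move=> X Y Z W; rewrite [X + Y]addrC -[Y + X + Z]addrA [X + Z]addrC
    addrA addrK addrAC.
apply: FilD; last first.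
  case: ifP => [/eqP e|_]; last exact: Fil0.
  by apply: FilZ; apply: Fil_le hx _; lia.
rewrite scalerDr -[X in Fil _ X]addrA; apply: FilD.
  by apply: FilZ; apply: Fil_le (Fil_S _ hx) _; lia.
have -> : (2 * rho)%N%:Z - i - j = (2 * rho)%N%:Z - (i + j) by lia.
case: eqP => [->|ne]; first by rewrite !subr0 scalerA subrr; exact: Fil0.
rewrite scale0r subr0.
have [lt|le] := ltrP (i + j) 0.
  by rewrite chi_gt ?scale0r ?scaler0; [exact: Fil0|lia].
by do 2!apply: FilZ; apply: Fil_le hx _; lia.
Qed.

(** To leading order, 2 kappa times the number operator of the Fock space. Truncation at N loses
    nothing in degree at most N, which every [twL (- j)] with j > N kills. *)
Definition weightop N (x : M) : M := \sum_(1 <= j < N.+1) twL j%:Z (twL (- j%:Z) x).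

Fact weightop_linear N : linear (weightop N).
Proof.
move=> a x y; rewrite /weightop scaler_sumr -big_split; apply: eq_bigr => j _.
by rewrite !linearP.
Qed.
HB.instance Definition _ N :=
  GRing.isLinear.Build A M M _ (weightop N) (weightop_linear N).

(** Pulling the operator through the first letter a, the only top-degree contribution is the
    commutator of [twL (- a)] and [twL a], namely 2 a kappa; the bound by N ensures that j = a
    occurs in the sum. *)
Lemma weightop_word N s : all (ltn 0) s -> (sumn s <= N)%N ->
  Fil ((sumn s)%:Z - 1) (weightop N (word s) - ((sumn s)%:R *+ 2 * kappa) *: word s).
Proof.
elim: s => [|a s IHs] /=.
  move=> _ _; rewrite mul0rn mul0r scale0r subr0 /weightop big1 ?linear0.
    exact: Fil0.
  by move=> j _; rewrite {2}/twL whittaker ?subrr ?linear0 //; lia.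
move=> /andP[a0 ps] le; rewrite -[L _ _]/(word (a :: s)) wordS //.
move: IHs => /(_ ps (leq_trans (leq_addl _ _) le)); set y := word s => IHs.
have hy : Fil (sumn s)%:Z y by apply: FilW.
have -> : weightop N (twL a%:Z y) = twL a%:Z (weightop N y) +
   (\sum_(1 <= j < N.+1)
      (twL j%:Z (twL a%:Z (twL (- j%:Z) y)) - twL a%:Z (twL j%:Z (twL (- j%:Z) y))) +
    \sum_(1 <= j < N.+1)
      twL j%:Z (twL (- j%:Z) (twL a%:Z y) - twL a%:Z (twL (- j%:Z) y))).
  rewrite /weightop linear_sum -!big_split; apply: eq_bigr => j _ /=.
  rewrite [X in _ = _ + (_ + X)](linearB (twL j%:Z)) addrA.
  by rewrite (addrC (twL a%:Z _)) subrK addrC subrK.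
have -> : ((a + sumn s)%:R *+ 2 * kappa) *: twL a%:Z y =
   twL a%:Z (((sumn s)%:R *+ 2 * kappa) *: y) +
    \sum_(1 <= j < N.+1) twL j%:Z
      ((if - j%:Z + a%:Z == 0 then (a%:Z - - j%:Z)%:~R * kappa else 0) *: y).
  rewrite linearZZ (bigD1_seq a) ?iota_uniq ?mem_index_iota /=; [|lia|by []].
  rewrite big1 ?addr0 => [|j ja].
    rewrite addNr eqxx linearZZ -scalerDl -mulrDl opprK.
    congr (_ * _ *: _); rewrite -PoszD -pmulrn -!mulrnA -mulrnDr.
    by congr (_ *+ _); lia.
  by rewrite ifF ?scale0r ?linear0 //; lia.
rewrite opprD addrACA; apply: FilD.
  by rewrite -linearB; apply: Fil_le (Fil_S _ IHs) _; lia.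
rewrite -[X in Fil _ X]addrA; apply: FilD.
  rewrite big_nat; apply: Fil_sum => j hj.
  have := Fil_comm j%:Z a%:Z (Fil_S (- j%:Z) hy).
  rewrite ifF ?scale0r ?subr0; last by lia.
  by move=> h; apply: Fil_le h _; lia.
rewrite -sumrB; apply: Fil_sum => j _.
rewrite -linearB; apply: Fil_le (Fil_S _ (Fil_comm _ _ hy)) _; lia.
Qed.

Lemma weightop_deg N d x : Fil d%:Z x -> (d <= N)%N ->
  Fil (d%:Z - 1) (weightop N x - (d%:R *+ 2 * kappa) *: x).
Proof.
move E: (d%:Z) => e hx; elim: hx E => [e' _ _|e' a x' y _ hx _ hy E le|
                                  e' s ps le E leN].
- by rewrite linear0 scaler0 subr0; exact: Fil0.
- set c := _ * kappa in hx hy *; rewrite linearP scalerDr opprD addrACA.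
  rewrite scalerA [c * a]mulrC -scalerA -scalerBr.
  by apply: FilL; [apply: hx | apply: hy].
- have hw := weightop_word ps.
  have [ed|ne] := eqVneq (sumn s) d.
    by rewrite -E -ed; apply: hw; lia.
  have hs : Fil (e' - 1) (word s) by apply: FilW => //; lia.
  rewrite -[weightop _ _](subrK (((sumn s)%:R *+ 2 * kappa) *: word s)).
  rewrite -addrA -scalerBl; apply: FilD; last exact: FilZ.
  by apply: Fil_le (hw N _) _; lia.
Qed.

(** This relation is exact, without lower-degree error: [chi] vanishes above 2 rho, so it is a
    character of the span of the L_n with n > rho. *)
Lemma Sneg_comm k l x : (0 < k)%N -> (0 < l)%N ->
  twL (- k%:Z) (twL (- l%:Z) x) = twL (- l%:Z) (twL (- k%:Z) x) +
    (k%:Z - l%:Z)%:~R *: twL (- (k + l + rho)%N%:Z) x.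
Proof.
move=> k0 l0; rewrite Scomm ifF ?addr0; last by lia.
rewrite chi_gt ?scale0r ?addr0; last by lia.
have -> : - l%:Z - - k%:Z = k%:Z - l%:Z by lia.
by have -> : - k%:Z + - l%:Z - rho%:Z = - (k + l + rho)%N%:Z by lia.
Qed.

Hypothesis spanned : forall x, exists d : nat, Fil d%:Z x.

Lemma dkappa_unit d : (0 < d)%N -> exists y, y * (d%:R *+ 2 * kappa) = 1.
Proof.
move=> d0; have [y hy] := kappa_unit.
have [x hx] := natA_unit (n := d * 2) ltac:(lia).
by exists (y * x); rewrite -mulrnA [_ * kappa]mulrC mulrACA hy hx mulr1.
Qed.

(** [weightop] kills such an x, so 2 d kappa x drops one degree; as 2 d kappa is a unit, x descends
    to degree 0. *)
Lemma Whittaker_vector x : (forall k, (0 < k)%N -> twL (- k%:Z) x = 0) ->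
  exists a, x = a *: v0.
Proof.
move=> h; have [d] := spanned x; elim: d => [|d IHd] hx; first exact: Fil_0 hx _.
apply: IHd; have [y hy] := dkappa_unit (ltn0Sn d).
rewrite -[x]scale1r -hy -scalerA; apply: FilZ.
have := weightop_deg hx (leqnn _); rewrite /weightop big_nat big1.
  rewrite sub0r => /(FilZ (-1)); rewrite scaleN1r opprK => hc.
  by apply: Fil_le hc _; lia.
by move=> j /andP[j0 _]; rewrite h // linear0.
Qed.

(* Vanishing of H^1 of span (L_n, n > rho) with values in M twisted by chi. *)
Lemma cocycle_solve d (u : nat -> M) :
  (forall k, (0 < k)%N -> Fil (d%:Z - k%:Z) (u k)) ->
  (forall k l, (0 < k)%N -> (0 < l)%N -> twL (- k%:Z) (u l) =
    twL (- l%:Z) (u k) + (k%:Z - l%:Z)%:~R *: u (k + l + rho)%N) ->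
  exists w, forall k, (0 < k)%N -> twL (- k%:Z) w = u k.
Proof.
elim: d u => [|d IHd] u hu cu.
  exists 0 => k k0; rewrite linear0 (Fil_lt0 (hu k k0)) //; lia.
have [y hy] := dkappa_unit (ltn0Sn d).
(* Contracting homotopy: [y *: w0], with y the inverse of 2 (d + 1) kappa, solves the equations to
   leading order, and the corrected cocycle [u'] lies one degree lower. *)
pose w0 := \sum_(1 <= j < d.+2) twL j%:Z (u j).
pose u' k := u k - twL (- k%:Z) (y *: w0).
have [k k0|k l k0 l0|w hw] := IHd u'; last first.
- by exists (w + y *: w0) => k k0; rewrite (linearD (twL _)) /= hw // subrK.
- rewrite /u' [LHS](linearB (twL _)) [X in _ = X + _](linearB (twL _)) /=.
  by rewrite cu // (Sneg_comm _ k0 l0) scalerBr opprD addrACA.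
have huk := hu k k0.
have hw0 : Fil d.+1%:Z w0.
  rewrite /w0 big_nat; apply: Fil_sum => j /andP[j0 _].
  by have := Fil_S j%:Z (hu j j0); rewrite subrK.
have [kd|dk] := leqP k d.+1; last first.
  rewrite /u' (Fil_lt0 huk); last by lia.
  by rewrite (Fil_lt0 (Fil_S _ (FilZ y hw0))) ?subrr; [exact: Fil0|lia].
rewrite /u' linearZZ -[u k]scale1r -{1}hy -scalerA -scalerBr /=.
apply: FilZ; rewrite -[X in Fil _ X]opprB -[X in Fil _ X]scaleN1r; apply: FilZ.
pose C j := twL (- k%:Z) (twL j%:Z (u j)) - twL j%:Z (twL (- k%:Z) (u j)) -
  (if - k%:Z + j%:Z == 0 then (j%:Z - - k%:Z)%:~R * kappa else 0) *: u j.
(* The Heisenberg relation contributes 2 k kappa u_k, and the cocycle identity turns the rest into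
   [weightop] of u_k, that is 2 (d + 1 - k) kappa u_k; together they make 2 (d + 1) kappa u_k up to
   lower degree. *)
have -> : twL (- k%:Z) w0 = \sum_(1 <= j < d.+2) C j +
    (k%:R *+ 2 * kappa) *: u k + (weightop d.+1 (u k) +
    \sum_(1 <= j < d.+2) (k%:Z - j%:Z)%:~R *: twL j%:Z (u (k + j + rho)%N)).
  have -> : (k%:R *+ 2 * kappa) *: u k = \sum_(1 <= j < d.+2)
      (if - k%:Z + j%:Z == 0 then (j%:Z - - k%:Z)%:~R * kappa else 0) *: u j.
    rewrite (bigD1_seq k) ?iota_uniq ?mem_index_iota /=; [|lia|by []].
    rewrite big1 ?addr0 => [|j jk].
      rewrite addNr eqxx opprK -PoszD -pmulrn -mulrnA.
      by congr (_ *+ _ * _ *: _); lia.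
    by rewrite ifF ?scale0r //; lia.
  rewrite linear_sum /weightop -!big_split !big_nat; apply: eq_bigr => j /andP[j0 _].
  by rewrite /= -linearZZ -linearD -cu // /C !subrK.
have -> : (d.+1%:R *+ 2 * kappa) *: u k =
    ((d.+1 - k)%:R *+ 2 * kappa) *: u k + (k%:R *+ 2 * kappa) *: u k.
  by rewrite -scalerDl -mulrDl -mulrnDl -natrD subnK.
have -> : forall X Y Z W U : M, X + Y + (Z + W) - (U + Y) = X + W + (Z - U).
  move=> X Y Z W U; rewrite opprD [LHS](AC (2*2*2) (1*4*(3*5)*(2*6))).
  by rewrite /= subrr addr0.
apply: FilD; last first.
  have huk' : Fil (d.+1 - k)%N%:Z (u k) by apply: Fil_le huk _; lia.
  by apply: Fil_le (weightop_deg huk' (leq_subr _ _)) _; lia.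
apply: FilD; rewrite big_nat; apply: Fil_sum => j /andP[j0 _].
  by apply: Fil_le (Fil_comm _ _ (hu j j0)) _; lia.
have hkj : (0 < k + j + rho)%N by lia.
by apply/FilZ/(Fil_le (Fil_S _ (hu _ hkj))); lia.
Qed.

(** One order in t of the deformation of the character at L_(2 rho + 1). The sequence supported at
    rho + 1 is a cocycle, since the bracket term has index k + l + rho > rho + 1. *)
Lemma extend_series x :
  (forall k, (0 < k)%N -> k != rho.+1 -> twL (- k%:Z) x = 0) ->
  exists y, forall k, (0 < k)%N -> twL (- k%:Z) y = if k == rho.+1 then x else 0.
Proof.
move=> h; have [e he] := spanned x.
(* The offset rho + 1 is chosen so that the value at k = rho + 1 has to lie in degree e. *)
apply: (@cocycle_solve (e + rho.+1)) => [k k0|k l k0 l0].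
  by case: eqP => [->|_]; [apply: Fil_le he _; lia | exact: Fil0].
rewrite [X in _ *: X]ifF ?scaler0 ?addr0; last by lia.
have [->//|kl] := eqVneq k l.
have [el|lp] := eqVneq l rho.+1; have [ek|kp] := eqVneq k rho.+1.
- by rewrite ek el eqxx in kl.
- by rewrite linear0 h.
- by rewrite linear0 h.
- by rewrite !linear0.
Qed.

End Filtration.

(** * Formal series with coefficients in a module *)

Section Convolution.
Local Open Scope ring_scope.
Variables (A : comNzRingType) (M : lmodType A).
Implicit Types (a b f : nat -> A) (v w : nat -> M) (p q : {poly A}).

(** Power series are their coefficient sequences: [conv] is the action of A[[t]] on M[[t]], [cmul]
    the product of A[[t]], [sder] the derivative in t. *)
Definition conv a v : nat -> M := fun N => \sum_(i < N.+1) a i *: v (N - i)%N.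

Definition cmul a b : nat -> A := fun N => \sum_(i < N.+1) a i * b (N - i)%N.

Definition sder (V : nmodType) (v : nat -> V) : nat -> V := fun N => v N.+1 *+ N.+1.

Definition pmul p v : nat -> M := conv (fun i => p`_i) v.

Lemma sum_triangle (V : nmodType) (F : nat -> nat -> nat -> V) N :
  \sum_(i < N.+1) \sum_(j < (N - i).+1) F i j (N - i - j)%N =
  \sum_(k < N.+1) \sum_(i < k.+1) F i (k - i)%N (N - k)%N.
Proof.
elim: N F => [|N IHN] F; first by rewrite !big_ord_recl !big_ord0.
rewrite big_ord_recl /=; rewrite (IHN (fun i => F i.+1)).
under [RHS]eq_bigr => k _ do rewrite big_ord_recl.
rewrite big_split /= subn0; congr (_ + _); rewrite ?subn0.
  by apply: eq_bigr => k _; rewrite subn0.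
rewrite [RHS]big_ord_recl big_ord0 add0r; apply: eq_bigr => k _.
by apply: eq_bigr => i _.
Qed.

Lemma cmulC a b : cmul a b = cmul b a.
Proof.
apply/funext => N; rewrite /cmul (reindex_inj rev_ord_inj) /=.
apply: eq_bigr => i _; rewrite subSS mulrC subKn //; have := ltn_ord i; lia.
Qed.

Lemma conv_conv a b v : conv a (conv b v) = conv (cmul a b) v.
Proof.
apply/funext => N; rewrite /conv /cmul.
under eq_bigr do rewrite scaler_sumr.
rewrite (sum_triangle (fun i j k => a i *: (b j *: v k))).
by apply: eq_bigr => k _; rewrite scaler_suml; apply: eq_bigr => i _; rewrite scalerA.
Qed.

Lemma convC a b v : conv a (conv b v) = conv b (conv a v).
Proof. by rewrite !conv_conv cmulC. Qed.

Lemma conv_additive a v w : conv a (fun N => v N + w N) =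
  fun N => conv a v N + conv a w N.
Proof.
apply/funext => N; rewrite /conv -big_split; apply: eq_bigr => i _.
by rewrite scalerDr.
Qed.

Lemma conv_sum a (I : finType) (F : I -> nat -> M) :
  conv a (fun N => \sum_i F i N) = fun N => \sum_i conv a (F i) N.
Proof.
apply/funext => N; rewrite /conv exchange_big; apply: eq_bigr => i _.
by rewrite scaler_sumr.
Qed.

Lemma conv_add a b v N : conv (fun i => a i + b i) v N = conv a v N + conv b v N.
Proof. by rewrite -big_split; apply: eq_bigr => i _; rewrite scalerDl. Qed.

Lemma conv_lin (f : {linear M -> M}) a v :
  (fun N => f (conv a v N)) = conv a (fun N => f (v N)).
Proof.
apply/funext => N; rewrite /conv linear_sum; apply: eq_bigr => i _.
by rewrite linearZ.
Qed.

Lemma sder_conv a v N : sder (conv a v) N = conv (sder a) v N + conv a (sder v) N.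
Proof.
rewrite /sder /conv.
rewrite -sumrMnl.
(* Leibniz rule: the factor N + 1 splits as i + (N + 1 - i), one part for each derivative. *)
have -> : \sum_(i < N.+2) a i *: v (N.+1 - i)%N *+ N.+1 =
  \sum_(i < N.+2) a i *: v (N.+1 - i)%N *+ i +
  \sum_(i < N.+2) a i *: v (N.+1 - i)%N *+ (N.+1 - i).
  by rewrite -big_split; apply: eq_bigr => i _; rewrite /= -mulrnDr subnKC // -ltnS.
rewrite big_ord_recl mulr0n add0r [X in _ + X]big_ord_recr /= subnn mulr0n addr0.
congr (_ + _); apply: eq_bigr => i _.
  by rewrite /bump subSS scalerMnl.
by rewrite scalerMnr subSn // -ltnS.
Qed.

Lemma pmulM p q v : pmul (p * q) v = pmul p (pmul q v).
Proof.
rewrite /pmul conv_conv; congr conv; apply/funext => N; exact: coefM.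
Qed.

Lemma pmulC c v N : pmul c%:P v N = c *: v N.
Proof.
rewrite /pmul /conv big_ord_recl coefC /= subn0 big1 ?addr0 // => i _.
by rewrite coefC scale0r.
Qed.

Lemma pmulD p q v N : pmul (p + q) v N = pmul p v N + pmul q v N.
Proof. by rewrite -conv_add; apply: eq_bigr => i _; rewrite coefD. Qed.

Lemma pmul0 v N : pmul 0 v N = 0.
Proof. by rewrite /pmul /conv big1 // => i _; rewrite coef0 scale0r. Qed.

Lemma pmul_sum (I : finType) (F : I -> {poly A}) v N :
  pmul (\sum_i F i) v N = \sum_i pmul (F i) v N.
Proof.
rewrite /pmul /conv exchange_big; apply: eq_bigr => i _.
by rewrite coef_sum scaler_suml.
Qed.

Lemma pmulX v N : pmul 'X v N = if N is N'.+1 then v N' else 0.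
Proof.
case: N => [|N]; rewrite /pmul /conv big_ord_recl coefX scale0r add0r.
  by rewrite big_ord0.
rewrite big_ord_recl coefX scale1r subSS subn0 big1 ?addr0 // => i _.
by rewrite coefX scale0r.
Qed.

Lemma cmulXn r b N : cmul (fun i => ('X^r : {poly A})`_i) b N =
  if (N < r)%N then 0 else b (N - r)%N.
Proof.
rewrite /cmul; case: ltnP => h.
  rewrite big1 // => i _; rewrite coefXn ltn_eqF ?mul0r //.
  by apply: leq_trans h.
rewrite -ltnS in h; rewrite (bigD1 (Ordinal h)) //= coefXn eqxx mul1r.
rewrite big1 ?addr0 // => i; rewrite -val_eqE /= => /negPf ne.
by rewrite coefXn ne mul0r.
Qed.

Lemma sder_pmul p v N : sder (pmul p v) N = pmul p^`() v N + pmul p (sder v) N.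
Proof.
rewrite /pmul sder_conv; congr (_ + _); apply: eq_bigr => i _.
by rewrite /sder coef_deriv.
Qed.

End Convolution.

(** * Deformed Whittaker series form a free A[[t]]-module of rank one *)

Section RankOne.
Local Open Scope ring_scope.
Variables (A : comNzRingType) (M : lmodType A) (K : nat -> {linear M -> M}).
Variables (v0 : M) (p : nat).
Hypothesis K_v0 : forall k, (0 < k)%N -> K k v0 = 0.
Hypothesis K_ker : forall x, (forall k, (0 < k)%N -> K k x = 0) ->
  exists a, x = a *: v0.
Hypothesis v0_free : forall a : A, a *: v0 = 0 -> a = 0.
Hypothesis K_ext : forall x, (forall k, (0 < k)%N -> k != p -> K k x = 0) ->
  exists y, forall k, (0 < k)%N -> K k y = if k == p then x else 0.

(** As series: K_p v = t v, and K_k v = 0 for the other positive k. *)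
Definition shifted (v : nat -> M) : Prop := forall k, (0 < k)%N ->
  forall N, K k (v N) = if k == p then (if N is N'.+1 then v N' else 0) else 0.

(** Iterate a choice of solutions of [K_ext], starting at [v0]; each solution again satisfies the
    condition [Q] required for the next step. *)
Lemma shifted_exists : exists2 w, shifted w & w 0%N = v0.
Proof.
pose Q x := forall k, (0 < k)%N -> k != p -> K k x = 0.
have /choice[f hf] x : exists y, Q x ->
    forall k, (0 < k)%N -> K k y = if k == p then x else 0.
  by have [/K_ext[y hy]|nq] := pselect (Q x); [exists y|exists 0].
have Qf N : Q (iter N f v0).
  elim: N => [|N IHN] k k0 kp; first exact: K_v0.
  by rewrite iterS hf // (negPf kp).
exists (fun N => iter N f v0) => // k k0 [|N]; first by rewrite K_v0 // if_same.
by rewrite iterS hf.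
Qed.

Variable w : nat -> M.
Hypothesis w_shifted : shifted w.
Hypothesis w0 : w 0%N = v0.

Lemma shifted_conv v : shifted v -> exists a, v = conv a w.
Proof.
have /choice[g hg] u : exists c, shifted u -> u 0%N = c *: v0.
  have [hu|nu] := pselect (shifted u); last by exists 0.
  have [k k0|c e] := @K_ker (u 0%N); first by rewrite hu // if_same.
  by exists c.
(* Division with remainder: v = g(v) w + t sg(v), since the constant term of v is a multiple of [v0]
   = w_0. The successive g are the coefficients of the multiplier. *)
pose sg v : nat -> M := fun N => v N.+1 - g v *: w N.+1.
have hs u : shifted u -> shifted (sg u).
  move=> hu k k0 N; rewrite /sg linearB linearZ /= hu // w_shifted //.
  case: eqP => // _; last by rewrite scaler0 subr0.
  by case: N => // ; rewrite hg // w0 subrr.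
move=> hv; exists (fun i => g (iter i sg v)); apply/funext => N.
elim: N v hv => [|N IHN] v hv.
  by rewrite /conv big_ord_recl big_ord0 addr0 /= w0 hg.
rewrite /conv big_ord_recl subn0 /= -[LHS](subrK (g v *: w N.+1)) addrC.
congr (_ + _); rewrite -[LHS]/(sg v N) (IHN _ (hs _ hv)).
by apply: eq_bigr => i _; rewrite -iterSr /= subSS.
Qed.

Lemma conv_shifted a : shifted (conv a w).
Proof.
move=> k k0 N; rewrite /conv linear_sum.
under eq_bigr do rewrite linearZ /= w_shifted //.
case: eqP => _; last by rewrite big1 // => i _; rewrite scaler0.
case: N => [|N]; first by rewrite big_ord_recl big_ord0 addr0 scaler0.
rewrite big_ord_recr /= subnn scaler0 addr0.
by apply: eq_bigr => i _; rewrite subSn // -ltnS.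
Qed.

(** At order N the new coefficient multiplies w_0 = [v0], which has zero annihilator; the others
    agree by induction. *)
Lemma conv_inj a b : conv a w = conv b w -> a = b.
Proof.
move=> e; apply/funext => N; have [n] := ubnP N; elim: n N => // n IHn N lt.
apply/eqP; rewrite -subr_eq0; apply/eqP/v0_free.
move/(congr1 (fun f => f N)): e; rewrite /conv !big_ord_recr /= subnn w0.
rewrite (eq_bigr (fun i : 'I_N => b i *: w (N - i)%N)) => [/addrI e|i _].
  by rewrite scalerBl e subrr.
by rewrite IHn //; have := ltn_ord i; lia.
Qed.

End RankOne.

(** * The scalar equation a f = t^r a' + G a in A[[t]] *)

Section ODE.
Local Open Scope ring_scope.
Variables (A : comNzRingType) (f : nat -> A) (r : nat).
Hypothesis natA_unit : forall n, (0 < n)%N -> exists y : A, y * n%:R = 1.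
Implicit Types (a h G : nat -> A).

Definition ode a G := forall N, cmul a f N =
  (if (N < r)%N then 0 else sder a (N - r)%N) + cmul G a N.

Lemma natA_inj n (x y : A) : x *+ n.+1 = y *+ n.+1 -> x = y.
Proof.
move=> e; have [c hc] := natA_unit (ltn0Sn n).
rewrite -[x]mulr1 -[y]mulr1 -hc [c * _]mulrC !mulrA !mulr_natr e //.
Qed.

Lemma cmul_low a h N : (forall i, (i < r)%N -> h i = 0) ->
  cmul a h N = if (N < r)%N then 0 else
    \sum_(i < (N - r).+1) a i * h (N - i)%N.
Proof.
move=> h0; rewrite /cmul; case: ltnP => lt.
  by rewrite big1 // => i _; rewrite h0 ?mulr0 //; lia.
have e : N.+1 = ((N - r).+1 + r)%N by lia.
rewrite -(big_mkord xpredT (fun i => a i * h (N - i)%N)) e.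
rewrite (big_cat_nat (n := (N - r).+1)) //= ?leq_addr // big_mkord.
rewrite [X in _ + X]big_nat [X in _ + X]big1 ?addr0 // => i hi.
by rewrite h0 ?mulr0 //; lia.
Qed.

Lemma cmulB a h G N : cmul a (fun i => h i - G i) N = cmul a h N - cmul G a N.
Proof.
rewrite (cmulC G) /cmul -sumrB; apply: eq_bigr => i _; exact: mulrBr.
Qed.

(** Written as a (f - G) = t^r a': since a has constant term 1, orders below r force G = f there;
    order r + m determines (m + 1) a_(m+1) from earlier terms. *)
Lemma odeP a G : a 0%N = 1 -> (forall i, (r <= i)%N -> G i = 0) ->
  ode a G <-> (forall i, (i < r)%N -> G i = f i) /\
    (forall m, a m.+1 *+ m.+1 = \sum_(i < m.+1) a i * f (r + m - i)%N).
Proof.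
move=> a0 G0.
have key : (forall i, (i < r)%N -> G i = f i) -> forall m,
    cmul a (fun i => f i - G i) (r + m) = \sum_(i < m.+1) a i * f (r + m - i)%N.
  move=> h m; rewrite cmul_low => [|i lt]; last by rewrite h ?subrr.
  rewrite ltnNge leq_addr /= addKn; apply: eq_bigr => i _.
  by rewrite G0 ?subr0 //; have := ltn_ord i; lia.
split=> [o|[h1 h2] N].
  have e N : cmul a (fun i => f i - G i) N =
      if (N < r)%N then 0 else sder a (N - r)%N by rewrite cmulB o addrK.
  have h1 i : (i < r)%N -> G i = f i.
    have [n] := ubnP i; elim: n i => // n IHn i lt lti.
    have := e i; rewrite lti /cmul big_ord_recl a0 mul1r subn0 big1 ?addr0.
      by move/eqP; rewrite subr_eq0 => /eqP.
    move=> j _; rewrite IHn ?subrr ?mulr0 //=;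
      by have := ltn_ord j; rewrite /bump /=; lia.
  split=> // m; rewrite -key // e ltnNge leq_addr /= addKn //.
apply/eqP; rewrite -subr_eq -cmulB; apply/eqP; case: ltnP => [lt|le].
  by rewrite cmul_low ?lt // => i lti; rewrite h1 ?subrr.
by rewrite -{1}(subnKC le) key // -h2.
Qed.

Lemma ode_exists : exists2 a, a 0%N = 1 &
  ode a (fun i => if (i < r)%N then f i else 0).
Proof.
have /choice[inv hinv] n : exists y : A, y * n.+1%:R = 1 by apply: natA_unit.
(* Course-of-values recursion: [sq n] lists a_0, ..., a_n, so [(size s).-1] is the m for which
   a_(m+1) is appended. *)
pose step s := rcons s
  (inv (size s).-1 * \sum_(i < size s) nth 0 s i * f (r + (size s).-1 - i)%N).
pose sq n := iter n step [:: 1].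
have ss n : size (sq n) = n.+1 by elim: n => //= n IHn; rewrite size_rcons IHn.
pose a n := nth 0 (sq n) n.
have sqE n m : (n <= m)%N -> nth 0 (sq m) n = a n.
  elim: m => [|m IHm]; first by rewrite leqn0 => /eqP->.
  rewrite leq_eqVlt => /predU1P[->//|lt].
  by rewrite /= nth_rcons ss lt IHm.
exists a => //; apply/odeP => [//|i|]; first by rewrite ltnNge => ->.
split=> [i ->//|m].
rewrite /a /= nth_rcons ss ltnn eqxx -mulr_natr mulrAC hinv mul1r /=.
by apply: eq_bigr => i _; rewrite sqE // -ltnS.
Qed.

Lemma ode_unique a b G H : a 0%N = 1 -> b 0%N = 1 ->
  (forall i, (r <= i)%N -> G i = 0) -> (forall i, (r <= i)%N -> H i = 0) ->
  ode a G -> ode b H -> a = b /\ G = H.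
Proof.
move=> a0 b0 G0 H0 /(odeP a0 G0)[Gf ra] /(odeP b0 H0)[Hf rb].
split; apply/funext => i; last first.
  by have [lt|le] := ltnP i r; [rewrite Gf ?Hf|rewrite G0 ?H0].
have [n] := ubnP i; elim: n i => // n IHn [|i] lt; first by rewrite a0.
apply: (@natA_inj i); rewrite ra rb; apply: eq_bigr => j _.
by rewrite IHn //; have := ltn_ord j; lia.
Qed.

End ODE.

(** * The operator L_* *)

Section Star.
Local Open Scope ring_scope.
Variables (A : comNzRingType) (M : lmodType A) (rho : nat).
Variables (L : int -> {linear M -> M}) (z : int -> A).
Variables (Lstarc : 'I_rho.+1 -> {poly A}) (Lam : nat -> {poly A}).
Hypothesis rho_gt0 : (0 < rho)%N.
Hypothesis vir : forall m n x, L m (L n x) =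
  L n (L m x) + (m - n)%:~R *: L (m + n) x +
  (if m + n == 0 then z m *: x else 0).
Hypothesis natA_unit : forall n, (0 < n)%N -> exists y : A, y * n%:R = 1.
Hypothesis Lam_gt : forall n, ((2 * rho).+1 < n)%N -> Lam n = 0.
Hypothesis star_bracket : forall n, (rho < n)%N ->
  \sum_m Lstarc m * ((n - m)%N%:R * Lam (n + m)) = 'X^(rho.+1) * (Lam n)^`().
Hypothesis Lstarc_max : exists y : A, y * (Lstarc ord_max)`_0 = 1.

Definition lact (n : nat) (v : nat -> M) : nat -> M := fun N => L n%:Z (v N).

Definition lstar (v : nat -> M) : nat -> M :=
  fun N => \sum_m pmul (Lstarc m) (lact m v) N.

Definition tdt (v : nat -> M) : nat -> M := pmul 'X^(rho.+1) (sder v).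

Definition eigen n v := lact n v = pmul (Lam n) v.

Definition star_eq (G : {poly A}) v := lstar v = fun N => tdt v N + pmul G v N.

Lemma lact_pmul n p v : lact n (pmul p v) = pmul p (lact n v).
Proof. exact: conv_lin. Qed.

Lemma lact_tdt n v : lact n (tdt v) = tdt (lact n v).
Proof.
rewrite /tdt lact_pmul; congr pmul; apply/funext => N.
by rewrite /lact /sder linearMn.
Qed.

Lemma tdt_pmul p v : tdt (pmul p v) =
  fun N => pmul p (tdt v) N + pmul ('X^(rho.+1) * p^`()) v N.
Proof.
rewrite /tdt; have -> : sder (pmul p v) =
    fun N => pmul p^`() v N + pmul p (sder v) N.
  by apply/funext => N; exact: sder_pmul.
rewrite /pmul conv_additive; apply/funext => N; rewrite addrC convC.
by congr (_ + _); rewrite -!/(pmul _ _) pmulM.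
Qed.

Lemma lact_comm m n v : (0 < m + n)%N -> (n <= m)%N -> lact m (lact n v) =
  fun N => lact n (lact m v) N + pmul (m - n)%N%:R (lact (m + n) v) N.
Proof.
move=> mn le; apply/funext => N; rewrite /lact vir ifF ?addr0; last by lia.
rewrite -PoszD subzn // -pmulrn -[(_ %:R : {poly A})](rmorph_nat (@polyC A)).
by rewrite pmulC.
Qed.

(** The added sum is the commutator of L_n with L_*. As n > rho >= m, the difference n - m is a
    natural number and no central term appears. *)
Lemma lact_lstar n v : (rho < n)%N -> eigen n v -> lact n (lstar v) =
  fun N => pmul (Lam n) (lstar v) N +
    \sum_m pmul (Lstarc m * (n - m)%N%:R) (lact (n + m) v) N.
Proof.
move=> rn en; apply/funext => N.
rewrite [pmul (Lam n) _]/pmul /lstar conv_sum -big_split /lact linear_sum.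
apply: eq_bigr => m _ /=.
rewrite -/(lact n _ N) lact_pmul -/(lact m v) lact_comm; last 2 first.
- by lia.
- by have := ltn_ord m; lia.
rewrite /pmul conv_additive; congr (_ + _); last by rewrite -!/(pmul _ _) pmulM.
by rewrite -[lact n v]/(lact n v) en lact_pmul /pmul convC.
Qed.

Lemma sum_eigen (n : nat) v (P : pred 'I_rho.+1) : (forall m, P m -> eigen (n + m) v) ->
  forall N, \sum_(m | P m) pmul (Lstarc m * (n - m)%N%:R) (lact (n + m) v) N =
   \sum_(m | P m) pmul (Lstarc m * ((n - m)%N%:R * Lam (n + m))) v N.
Proof.
by move=> h N; apply: eq_bigr => m Pm; rewrite h // /eigen -pmulM mulrA.
Qed.

Definition annihilated v := forall n, (rho < n)%N -> eigen n v.

(** Commuting L_n past L_* produces the left side of [star_bracket], while t^r d/dt differentiating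
    [Lam n] produces the right side; the two cancel. *)
Lemma annihilated_defect v : annihilated v ->
  annihilated (fun N => lstar v N - tdt v N).
Proof.
move=> hv n rn; apply/funext => N; rewrite /lact linearB.
rewrite -!/(lact n _ N) lact_lstar // ?lact_tdt; last exact: hv.
rewrite hv // tdt_pmul sum_eigen; last by move=> m _; apply: hv; lia.
rewrite -pmul_sum star_bracket // opprD [RHS](_ : _ = pmul (Lam n) (lstar v) N +
  - pmul (Lam n) (tdt v) N); last first.
  rewrite /pmul conv_additive; congr (_ + _); rewrite /conv -sumrN.
  by apply: eq_bigr => i _; rewrite scalerN.
rewrite addrACA [X in _ + X](_ : _ = 0) ?addr0 //.
by apply/eqP; rewrite subr_eq0.
Qed.

(** A polynomial with unit constant term is invertible in A[[t]]. *)
Lemma pmul_eq0 (p : {poly A}) (v : nat -> M) : (exists y : A, y * p`_0 = 1) ->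
  (forall N, pmul p v N = 0) -> forall N, v N = 0.
Proof.
move=> [y hy] h N; have [n] := ubnP N; elim: n N => // n IHn N lt.
have := h N; rewrite /pmul /conv big_ord_recl subn0 big1 ?addr0 => [e|i _].
  by rewrite -[v N]scale1r -hy -scalerA e scaler0.
by rewrite IHn ?scaler0 // lift0; have := ltn_ord i; lia.
Qed.

Lemma star_annihilated G v : star_eq G v ->
  (forall n, (rho < n <= (2 * rho).+1)%N -> eigen n v) -> annihilated v.
Proof.
move=> sv ev.
have rn : (rho < rho.+2)%N by lia.
have en : eigen rho.+2 v by apply: ev; lia.
(* The index rho + 2 is chosen so that rho + 2 + m exceeds the known range, which ends at 2 rho + 1,
   only for m = rho. *)
have brack N : \sum_m pmul (Lstarc m * (rho.+2 - m)%N%:R) (lact (rho.+2 + m) v) N =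
    pmul ('X^(rho.+1) * (Lam rho.+2)^`()) v N.
  have := congr1 (fun f => f N) (lact_lstar rn en); rewrite {1}sv.
  rewrite {1}/lact linearD -[L _ (tdt v N)]/(lact _ _ N) lact_tdt en tdt_pmul.
  rewrite -[L _ (pmul G v N)]/(lact _ _ N) lact_pmul en sv.
  rewrite [pmul (Lam _) (fun N => _ + _)]conv_additive /pmul convC.
  by rewrite addrAC => /addrI.
(* Subtracting [star_bracket] cancels all terms with m < rho; what remains is twice the last
   coefficient of L_*, invertible in A[[t]], times this vector. *)
have top N : lact (rho.+2 + rho) v N = 0.
  apply: (@pmul_eq0 (Lstarc ord_max * 2%:R)) N => [|N].
    have [[x hx] [y hy]] := (Lstarc_max, natA_unit (n := 2) isT).
    exists (x * y).
    have -> : 2%:R = (2%:R)%:P :> {poly A} by rewrite rmorph_nat.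
    by rewrite coefMC mulrACA hx hy mulr1.
  have := brack N; rewrite -star_bracket // pmul_sum.
  rewrite (bigD1 ord_max) // [RHS](bigD1 ord_max) //=.
  rewrite Lam_gt ?mulr0 ?pmul0; last by lia.
  rewrite sum_eigen => [/addIr|m]; first by have -> : (rho.+2 - rho = 2)%N by lia.
  by rewrite -val_eqE /= => ne; apply: ev; have := ltn_ord m; lia.
have r1 : eigen rho.+1 v by apply: ev; lia.
move=> n; have [k] := ubnP n; elim: k n => // k IHk n lt rho_n.
have [le|gt] := leqP n (2 * rho).+1; first by apply: ev; rewrite rho_n.
have [e|ne] := eqVneq n (rho.+2 + rho)%N.
  by apply/funext => N; rewrite e top Lam_gt ?pmul0 //; lia.
(* Here n > 2 rho + 2, so the bracket of L_(n - rho - 1) with L_(rho + 1) is a nonzero integer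
   multiple of L_n, while both act on v by commuting scalars. *)
have [en1 lt1] : eigen (n - rho.+1) v /\ (rho.+1 < n - rho.+1)%N.
  by split; [apply: IHk|]; lia.
have := @lact_comm (n - rho.+1) rho.+1 v ltac:(lia) (ltnW lt1).
rewrite en1 r1 !lact_pmul en1 r1 /pmul convC => /(congr1 (fun f : nat -> M => f _)) e.
apply/funext => N; rewrite Lam_gt // pmul0; move: N.
apply: (@pmul_eq0 (n - rho.+1 - rho.+1)%N%:R) => [|N].
  have [y hy] := natA_unit (n := (n - rho.+1 - rho.+1)%N) ltac:(lia).
  by exists y; rewrite -(rmorph_nat (@polyC A)) coefC.
have := e N; rewrite subnK; last by lia.
by move/eqP; rewrite -[X in X == _]addr0 (inj_eq (addrI _)) eq_sym => /eqP.
Qed.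

Lemma lstar_conv a v : lstar (conv a v) = conv a (lstar v).
Proof.
rewrite /lstar conv_sum; apply/funext => N; apply: eq_bigr => m _.
by rewrite /pmul convC; congr (conv _ _ N); apply: conv_lin.
Qed.

Lemma tdt_conv a v : tdt (conv a v) = fun N =>
  conv (cmul (fun i => ('X^(rho.+1) : {poly A})`_i) (sder a)) v N + conv a (tdt v) N.
Proof.
rewrite /tdt; have -> : sder (conv a v) =
    fun N => conv (sder a) v N + conv a (sder v) N.
  by apply/funext => N; exact: sder_conv.
by rewrite /pmul conv_additive conv_conv convC.
Qed.

Variables (v0 : M) (w : nat -> M).
Hypothesis v0_free : forall a : A, a *: v0 = 0 -> a = 0.
Hypothesis w_ann : annihilated w.
Hypothesis w0 : w 0%N = v0.
Hypothesis ann_conv : forall v, annihilated v <-> exists a, v = conv a w.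

Definition star_solution (G : {poly A}) v := [/\ v 0%N = v0, star_eq G v &
  forall n, (rho < n <= (2 * rho).+1)%N -> eigen n v].

Lemma star_solution_unique_existence :
  exists2 s : {poly A} * (nat -> M),
    (size s.1 <= rho.+1)%N /\ star_solution s.1 s.2 &
    forall (G : {poly A}) v, (size G <= rho.+1)%N -> star_solution G v -> (G, v) = s.
Proof.
have [f hf] : exists f, (fun N => lstar w N - tdt w N) = conv f w.
  exact/ann_conv/annihilated_defect.
(* L_* is A[[t]]-linear and t^r d/dt is a derivation, so the equation for a w becomes one for a
   after cancelling w by [conv_inj]. *)
have star_ode a (G : {poly A}) :
    star_eq G (conv a w) <-> ode f rho.+1 a (fun i => G`_i).
  rewrite /star_eq lstar_conv tdt_conv /pmul conv_conv.
  have -> : lstar w = fun N => conv f w N + tdt w N.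
    by apply/funext => N; rewrite -hf subrK.
  rewrite conv_additive conv_conv; set X := cmul _ (sder a).
  have -> : ode f rho.+1 a (fun i => G`_i) <->
      cmul a f = fun N => X N + cmul (fun i => G`_i) a N.
    split=> [h|h N]; last by rewrite h /X cmulXn.
    by apply/funext => N; rewrite h /X cmulXn.
  split=> [h|->].
    apply: (conv_inj v0_free w0); apply/funext => N; rewrite conv_add.
    move/(congr1 (fun f : nat -> M => f N)): h => /eqP.
    by rewrite addrAC (inj_eq (addIr _)) => /eqP.
  by apply/funext => N; rewrite conv_add addrAC.
have head (a : nat -> A) : conv a w 0%N = a 0%N *: v0.
  by rewrite /conv big_ord_recl big_ord0 addr0 w0.
have [a a0 oa] := ode_exists f rho.+1 natA_unit.
(* The exponential prefactor is dictated by f modulo t^r. *)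
exists (\poly_(i < rho.+1) f i, conv a w) => [|G v sG [hv0 hG hv]] /=.
  split; first exact: size_poly.
  split; first by rewrite head a0 scale1r.
    apply/star_ode => N; rewrite oa; congr (_ + _).
    by apply: eq_bigr => i _; rewrite coef_poly.
  by move=> n /andP[hn _]; apply: (proj2 (ann_conv _)) hn; exists a.
have [b eb] := (proj1 (ann_conv v)) (star_annihilated hG hv); subst v.
have b0 : b 0%N = 1.
  apply/eqP; rewrite -subr_eq0; apply/eqP/v0_free.
  by rewrite scalerBl scale1r -head hv0 subrr.
have [||ab eG] := ode_unique natA_unit b0 a0 _ _ (proj1 (star_ode _ _) hG) oa.
- by move=> i hi; apply: nth_default; apply: leq_trans hi.
- by move=> i hi; rewrite ltnNge hi.
congr (_, conv _ _); last exact: ab.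
apply/polyP => i; rewrite coef_poly; exact: (congr1 (fun f => f i) eG).
Qed.

End Star.

(** * Valuations of the coefficients of L_*, and the existence and uniqueness of the series *)

Section Assembly.
Local Open Scope ring_scope.
Variables (A : comNzRingType) (M : lmodType A) (rho : nat).
Variables (L : int -> {linear M -> M}) (v0 : M) (chi z : int -> A).
Variables (Lstarc : 'I_rho.+1 -> {poly A}) (Lam : nat -> {poly A}).
Hypothesis rho_gt0 : (0 < rho)%N.
Hypothesis vir : forall m n x, L m (L n x) =
  L n (L m x) + (m - n)%:~R *: L (m + n) x +
  (if m + n == 0 then z m *: x else 0).
Hypothesis chi_lt : forall n, n < rho%:Z -> chi n = 0.
Hypothesis chi_gt : forall n, (2 * rho)%N%:Z < n -> chi n = 0.
Hypothesis whittaker : forall n, rho%:Z <= n -> L n v0 = chi n *: v0.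
Hypothesis natA_unit : forall n, (0 < n)%N -> exists y : A, y * n%:R = 1.
Hypothesis kappa_unit : exists y : A, y * chi (2 * rho)%N%:Z = 1.
Hypothesis spanned : forall x, exists d : nat, Fil rho L v0 d%:Z x.
Hypothesis v0_free : forall a : A, a *: v0 = 0 -> a = 0.
Hypothesis LamE : forall n, (rho < n)%N ->
  Lam n = (chi n%:Z)%:P + (if n == (2 * rho).+1 then 'X else 0).
Hypothesis star_bracket : forall n, (rho < n)%N ->
  \sum_m Lstarc m * ((n - m)%N%:R * Lam (n + m)) = 'X^(rho.+1) * (Lam n)^`().

Let Lam_gt n : ((2 * rho).+1 < n)%N -> Lam n = 0.
Proof.
by move=> hn; rewrite LamE ?chi_gt ?ifF ?addr0 ?polyC0 //; lia.
Qed.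

(* The bracket identities are triangular in the coefficients of L_*. *)
Lemma Lstarc_low (m : 'I_rho.+1) :
  (forall i, (i < rho - m)%N -> (Lstarc m)`_i = 0) /\
  exists y, y * (Lstarc m)`_(rho - m)%N = 1.
Proof.
case: m => m; have [n] := ubnP m; elim: n m => // n IHn m lt hm.
(* Take the coefficient of t^(i+1) in the identity for n = 2 rho + 1 - m: [Lam] of n + j is t for j
   = m, zero for j > m, and a constant value of [chi] for j < m. *)
have coefs i : (i <= rho - m)%N ->
    (Lstarc (Ordinal hm))`_i *+ ((2 * rho).+1 - m - m) +
    \sum_(j < rho.+1 | (j < m)%N)
      chi ((2 * rho).+1 - m + j)%N%:Z * (Lstarc j)`_i.+1 *+ ((2 * rho).+1 - m - j) =
    ((m == 0%N) && (i == rho))%:R.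
  move=> hi; have := @star_bracket ((2 * rho).+1 - m)%N ltac:(lia).
  move/(congr1 (fun p : {poly A} => p`_i.+1)).
  rewrite LamE; last by lia.
  rewrite derivD derivC add0r.
  have -> : (if ((2 * rho).+1 - m == (2 * rho).+1)%N then 'X else 0 : {poly A})^`() =
      (m == 0%N)%:R.
    have -> : ((2 * rho).+1 - m == (2 * rho).+1)%N = (m == 0%N) by lia.
    by case: ifP; rewrite ?derivX ?deriv0.
  have -> : ('X^(rho.+1) * (m == 0%N)%:R : {poly A})`_i.+1 =
      ((m == 0%N) && (i == rho))%:R.
    by case: (m == 0%N); rewrite ?mulr1 ?mulr0 ?coef0 // coefXn.
  move<-; rewrite coef_sum [RHS](bigD1 (Ordinal hm)) //=; congr (_ + _).
    rewrite LamE ?subnK ?eqxx ?chi_gt; try lia.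
    by rewrite polyC0 add0r mulrA coefMX /= mulr_natr coefMn.
  rewrite [RHS](bigID (fun j : 'I_rho.+1 => (j < m)%N)) /= [X in _ = _ + X]big1 ?addr0.
    apply: eq_big => [j|j jm].
      by rewrite -val_eqE /= ; lia.
    rewrite LamE ?ifF ?addr0; try lia.
    by rewrite mulr_natl mulrnAr coefMn coefMC mulrC.
  move=> j; rewrite -val_eqE /= => hj; rewrite Lam_gt ?mulr0 ?coef0 //; lia.
split=> [i /= hi|/=].
  have := coefs i (ltnW hi); rewrite (_ : (_ && _) = false); last by lia.
  rewrite big1 ?addr0 => [e|j jm]; last first.
    have jn : (j < n)%N by lia.
    have [h _] := IHn j jn (ltn_ord j).
    rewrite (_ : Ordinal _ = j) in h; last exact: val_inj.
    by rewrite h ?mulr0 ?mul0rn //; lia.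
  have [y hy] := @natA_unit ((2 * rho).+1 - m - m)%N ltac:(lia).
  by rewrite -[LHS]mulr1 -hy mulrCA mulr_natr e mulr0.
have {coefs} := coefs (rho - m)%N (leqnn _).
case: m lt hm => [|m] lt hm.
  rewrite big1 // addr0 !subn0 !eqxx => e.
  by exists (2 * rho).+1%:R; rewrite mulr_natl.
have hm' : (m < rho.+1)%N := ltnW hm.
have mn : (m < n)%N by lia.
rewrite (bigD1 (Ordinal hm')) //= big1 ?addr0 => [|j /andP[jm]]; last first.
  rewrite -val_eqE /= => ne; have jn : (j < n)%N by lia.
  have [h _] := IHn j jn (ltn_ord j).
  rewrite (_ : Ordinal _ = j) in h; last exact: val_inj.
  by rewrite h ?mulr0 ?mul0rn //; lia.
have [_ [x hx]] := IHn m mn hm'.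
have -> : (rho - m.+1).+1 = (rho - m)%N by lia.
have -> : ((2 * rho).+1 - m.+1 + m)%N = (2 * rho)%N by lia.
have [t ht] := kappa_unit.
have [y hy] := @natA_unit ((2 * rho).+1 - m.+1 - m)%N ltac:(lia).
set k := (_ - _ - m.+1)%N; move/eqP; rewrite addr_eq0 => /eqP e.
(* Only j = m survives: k times the leading coefficient at m + 1 is minus an integer times kappa
   times the one at m; [t], [x] and [y] invert kappa, that coefficient and the integer. *)
exists (- (t * x * y * k%:R)); rewrite mulNr -(mulrA _ k%:R) mulr_natl e mulrN opprK.
by rewrite -[_ *+ _]mulr_natr mulrACA [t * x * _]mulrACA ht hx hy !mulr1.
Qed.

(** With n = rho + k, [Lam n] differs from [chi n] only by the t at k = rho + 1, so moving [chi] to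
    the left gives the shifted equations. *)
Lemma annihilatedP v : annihilated rho L Lam v <->
  shifted (fun k => twL rho L chi (- k%:Z) : {linear M -> M}) rho.+1 v.
Proof.
have key k N : (0 < k)%N -> pmul (Lam (rho + k)) v N = chi (rho + k)%N%:Z *: v N +
    (if k == rho.+1 then (if N is N'.+1 then v N' else 0) else 0).
  move=> k0; rewrite LamE; last by lia.
  rewrite pmulD pmulC; congr (_ + _).
  have -> : (rho + k == (2 * rho).+1)%N = (k == rho.+1) by lia.
  by case: eqP; rewrite ?pmulX ?pmul0.
split=> [h k k0 N|h n hn].
  have := congr1 (fun f => f N) (h (rho + k)%N ltac:(lia)).
  rewrite key // /lact /= /twL opprK -PoszD => ->.
  by rewrite addrC addKr.
apply/funext => N; have e : n = (rho + (n - rho))%N by lia.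
rewrite e key; last by lia.
have := h (n - rho)%N ltac:(lia) N; rewrite /= /twL opprK -PoszD -e => <-.
by rewrite addrC subrK.
Qed.

Lemma irregular_series : exists2 s : {poly A} * (nat -> M),
    (size s.1 <= rho.+1)%N /\ star_solution L Lstarc Lam v0 s.1 s.2 &
    forall (G : {poly A}) v, (size G <= rho.+1)%N ->
      star_solution L Lstarc Lam v0 G v -> (G, v) = s.
Proof.
have K_v0 k : (0 < k)%N -> twL rho L chi (- k%:Z) v0 = 0.
  by move=> k0; rewrite /twL whittaker ?subrr //; lia.
have K_ker := Whittaker_vector rho_gt0 vir chi_lt chi_gt whittaker natA_unit
  kappa_unit spanned.
have K_ext := extend_series rho_gt0 vir chi_lt chi_gt whittaker natA_unit
  kappa_unit spanned.
pose K k : {linear M -> M} := twL rho L chi (- k%:Z).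
have [w sw w0] := @shifted_exists _ _ K v0 rho.+1 K_v0 K_ext.
apply: (star_solution_unique_existence rho_gt0 vir natA_unit Lam_gt star_bracket
  _ v0_free _ w0).
- have [_] := Lstarc_low ord_max; by rewrite subnn.
- exact/annihilatedP.
move=> v; split=> [/annihilatedP hv|[a ->]].
  exact: (@shifted_conv _ _ K v0 rho.+1 K_ker w sw w0).
exact/annihilatedP/conv_shifted.
Qed.

End Assembly.

(** * The coefficient ring A *)

Section Prefactor.
Local Open Scope ring_scope.
Variables (A : comNzRingType) (rho : nat).
Hypothesis natA_unit : forall n, (0 < n)%N -> exists y : A, y * n%:R = 1.

Definition prefactor (nu : A) (g : {ffun 'I_rho -> A}) : {poly A} :=
  nu *: 'X^rho - \sum_(i < rho) (i.+1%:R * g i) *: 'X^(rho.+1 - i.+2).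

Lemma coef_prefactor nu g k : (prefactor nu g)`_k =
  if k == rho then nu else oapp (fun i : 'I_rho => - (i.+1%:R * g i)) 0
    (insub (rho - k.+1)%N) *+ (k < rho)%N.
Proof.
rewrite coefB coefZ coefXn coef_sum.
have [->|ne] := eqVneq k rho.
  rewrite mulr1 big1 ?subr0 // => i _.
  by rewrite coefZ coefXn gtn_eqF ?mulr0 //; have := ltn_ord i; lia.
rewrite mulr0 sub0r; have [lt|le] := ltnP k rho; last first.
  rewrite big1 ?oppr0 // => i _; rewrite coefZ coefXn gtn_eqF ?mulr0 //.
  by have := ltn_ord i; lia.
have hi : (rho - k.+1 < rho)%N by lia.
rewrite insubT (bigD1 (Ordinal hi)) //= coefZ coefXn big1 => [|i].
  by rewrite addr0 (_ : (_ == _)%N) ?mulr1 //; apply/eqP; lia.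
rewrite -val_eqE /= => ine; rewrite coefZ coefXn (_ : (_ == _)%N = false) ?mulr0 //.
by have := ltn_ord i; move: ine; lia.
Qed.

Lemma size_prefactor nu g : (size (prefactor nu g) <= rho.+1)%N.
Proof.
apply/leq_sizeP => k le; rewrite coef_prefactor gtn_eqF //.
by rewrite ltnNge ltnW.
Qed.

Lemma prefactor_inj nu g nu' g' : prefactor nu g = prefactor nu' g' ->
  nu = nu' /\ g = g'.
Proof.
move=> e; split.
  by move/(congr1 (fun p : {poly A} => p`_rho)): e; rewrite !coef_prefactor eqxx.
apply/ffunP => i; move/(congr1 (fun p : {poly A} => p`_(rho - i.+1))): e.
have hi := ltn_ord i; rewrite !coef_prefactor ltn_eqF; last by lia.
have -> : (rho - (rho - i.+1).+1 = i)%N by lia.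
rewrite valK /= (_ : (_ < _)%N); last by lia.
move=> /oppr_inj; have [y hy] := natA_unit (ltn0Sn i).
by move/(congr1 ( *%R y)); rewrite !mulrA hy !mul1r.
Qed.

(** The coefficient of t^rho is nu and that of t^(rho - j) is - j g_j; positive integers are
    invertible, so every such polynomial arises. *)
Lemma prefactor_surj (G : {poly A}) : (size G <= rho.+1)%N ->
  exists nu g, G = prefactor nu g.
Proof.
move=> sG; have /choice[inv hinv] n : exists y : A, y * n.+1%:R = 1.
  exact: natA_unit.
exists G`_rho, [ffun i : 'I_rho => - (inv i * G`_(rho - i.+1))].
apply/polyP => k; rewrite coef_prefactor; case: eqP => [->//|ne].
have [lt|le] := ltnP k rho; last by rewrite nth_default ?(leq_trans sG) ?mulr0n //; lia.
have hi : (rho - k.+1 < rho)%N by lia.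
rewrite insubT /= ffunE mulrN opprK mulrA [_ * inv _]mulrC hinv mul1r /=.
by congr (G`_ _); lia.
Qed.

End Prefactor.

(** * Units of A and the character of the Whittaker vector *)

Section Instance.
Local Open Scope ring_scope.
Variables (C : numFieldType) (rho : nat).
Hypothesis rho_gt0 : (0 < rho)%N.
Local Notation r := rho.+1.
Local Notation A := (coefA C r).

Lemma coefA_nat_unit n : (0 < n)%N -> exists y : A, y * n%:R = 1.
Proof.
move=> n0; exists (polyA (n%:R^-1)%:MP).
rewrite -(rmorph_nat (@polyA C r)) -rmorphM /=.
have -> : (n%:R : cpoly C r) = (n%:R)%:MP by rewrite rmorph_nat.
rewrite -mpolyCM mulVf ?mpolyC1 ?rmorph1 //.
have -> : (n%:R : baseF C) = tofrac (n%:R : C)%:MP by rewrite !rmorph_nat.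
by rewrite tofrac_eq0 mpolyC_eq0 pnatr_eq0 -lt0n.
Qed.

Lemma c_last_unit : exists y : A, y * polyA (cvar C r rho) = 1.
Proof.
have h : (tofrac (cvar C r rho)%:P)^-1 \in @in_coefA C r.
  by apply/asboolP; exists 1, 1%N; rewrite expr1 tofrac1 div1r.
exists (CoefA h); apply: val_inj => /=.
by rewrite mulVf // (cF_neq0 C r).
Qed.

Lemma quadc_gt n : (2 * rho < n)%N -> quadc C r n = 0.
Proof.
move=> hn; rewrite /quadc big_nat big1 // => p hp.
by rewrite big_nat_cond big1 // => q /andP[hq /eqP hpq]; lia.
Qed.

Lemma quadc_top : quadc C r (2 * rho) = cvar C r rho ^+ 2.
Proof.
rewrite /quadc big_nat_recr //= big_nat big1 ?add0r => [|p hp]; last first.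
  by rewrite big_nat_cond big1 // => q /andP[hq /eqP hpq]; lia.
rewrite big_mkcond big_nat_recr //= big_nat big1 ?add0r => [|q hq]; last first.
  by rewrite ifF //; lia.
by rewrite ifT ?expr2 //; lia.
Qed.

(** Extended by 0 below rho, so that twisting does not alter the creation operators. *)
Definition chiA (n : int) : A :=
  if n is Posz k then if (rho <= k)%N then polyA (Lambda' C r k) else 0 else 0.

Lemma chiA_nat k : (rho < k)%N -> chiA k%:Z = polyA (- quadc C r k).
Proof.
move=> lt; rewrite /chiA ltnW // /Lambda' gtn_eqF // mul0r mul0r sub0r.
by [].
Qed.

Lemma chiA_lt n : n < rho%:Z -> chiA n = 0.
Proof. by case: n => //= n lt; rewrite ifF //; lia. Qed.

Lemma chiA_gt n : (2 * rho)%N%:Z < n -> chiA n = 0.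
Proof.
case: n => //= n lt; rewrite -[LHS]/(chiA n%:Z) chiA_nat; last by lia.
by rewrite quadc_gt ?oppr0 ?rmorph0.
Qed.

Lemma chiA_top_unit : exists y : A, y * chiA (2 * rho)%N%:Z = 1.
Proof.
rewrite chiA_nat; last by lia.
have [y hy] := c_last_unit; exists (- (y * y)).
by rewrite quadc_top rmorphN mulrNN rmorphXn expr2 mulrACA hy mulr1.
Qed.

(** Above rho the term of Lambda'_n linear in Q and c_0 is gone, and only the weight t at n = 2 r -
    1 is new. *)
Lemma LambdaA_chiA n : (rho < n)%N -> LambdaA C r n =
  (chiA n%:Z)%:P + (if n == (2 * rho).+1 then 'X else 0).
Proof.
move=> lt; have e : (2 * r).-1 = (2 * rho).+1 by lia.
rewrite chiA_nat //; case: eqP => [->|/eqP ne].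
  by rewrite -{1}e LamAX quadc_gt // oppr0 rmorph0 polyC0 add0r.
by rewrite addr0 /LambdaA LamC ?e // map_polyC.
Qed.

End Instance.

(** * L_* acts on the weights Lambda_n as t^r d/dt *)

Section StarBracket.
Local Open Scope ring_scope.
Variables (C : numFieldType) (r : nat).
Hypothesis hr : (2 <= r)%N.
Local Notation A := (coefA C r).

Lemma evalA_sum (I : finType) (F : I -> {poly A}) :
  evalA (\sum_i F i) = \sum_i evalA (F i).
Proof. exact: (raddf_sum (@evalA C r)). Qed.

Lemma evalA_nat n : evalA (n%:R : {poly A}) = n%:R.
Proof. exact: (rmorph_nat (@evalA C r)). Qed.

(** The last row of the Jacobian of the weights is the last unit vector, so the inverses of [calM]
    and [brackM] share their last row. *)
Lemma evalA_Lstar_brackM m :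
  evalA (Lstar_coef C m) = tofrac 'X ^+ r * invmx (brackM C r) ord_max m.
Proof.
have e := @evalA_Lstar_coef C r hr m.
have e' := @invmx_calM_last C r hr m.
have e2 := etrans e (congr1 (fun y => tofrac 'X ^+ r * y) e').
exact: e2.
Qed.

Lemma evalA_brack (m k : 'I_r.-1.+1) n : (r + k = n)%N ->
  evalA ((n - m)%N%:R * LambdaA C r (n + m)) = brackM C r m k.
Proof.
move=> <-; rewrite evalAM evalA_nat evalA_LamA.
by rewrite [RHS]mxE.
Qed.

(** Up to the factor t^r this is the last row of [brackM]^-1 [brackM] = 1, whose entries are the
    derivatives of Lambda_n in t; the identity is checked in the fraction field. Beyond 2 r - 1 both
    sides vanish. *)
Lemma star_bracketA n : (r <= n)%N ->
  \sum_(m < r.-1.+1) Lstar_coef C m * ((n - m)%N%:R * LambdaA C r (n + m)) =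
  'X^r * (LambdaA C r n)^`().
Proof.
move=> lt; have [le|gt] := leqP n (2 * r).-1; last first.
  rewrite (LamA_eq0 _ hr) ?deriv0 ?mulr0; last by lia.
  by rewrite big1 // => m _; rewrite (LamA_eq0 _ hr) ?mulr0 //; lia.
apply: (@evalA_inj C r).
have hk : (n - r < r.-1.+1)%N by lia.
pose k := Ordinal hk; have ek : (r + k = n)%N by rewrite /= subnKC.
rewrite evalA_sum.
transitivity (tofrac 'X ^+ r * \sum_m invmx (brackM C r) ord_max m * brackM C r m k).
  rewrite mulr_sumr; apply: eq_bigr => m _.
  by rewrite evalAM (evalA_brack m ek) evalA_Lstar_brackM -mulrA.
have := congr1 (fun B : 'M_(r.-1.+1) => B ord_max k) (mulVmx (brackM_unit C hr)).
rewrite mxE => ->; rewrite evalAM evalAXn; congr (_ * _).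
rewrite mxE.
rewrite (_ : (ord_max == k) = (n == (2 * r).-1)); last first.
  by rewrite -val_eqE -ek /=; lia.
case: eqP => [->|/eqP ne]; first by rewrite LamAX derivX (evalA_nat 1).
by rewrite /LambdaA LamC // map_polyC derivC (evalA_nat 0).
Qed.

End StarBracket.

(** * The irregular Verma module and the conclusion *)

Section Verma.
Local Open Scope ring_scope.
Variables (C : numFieldType) (rho : nat).
Hypothesis rho_gt0 : (0 < rho)%N.
Local Notation r := rho.+1.
Local Notation A := (coefA C r).
Variables (M : lmodType A) (L : int -> {linear M -> M}) (v0 : M).
Hypothesis hM : irregular_verma L v0.

Definition central (m : int) : A :=
  cstA r ((m ^+ 3 - m)%:~R / 12%:R * (1 + 6%:R * parQ C ^+ 2)).

Lemma vir_comm m n x : L m (L n x) =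
  L n (L m x) + (m - n)%:~R *: L (m + n) x +
  (if m + n == 0 then central m *: x else 0).
Proof. by rewrite -addrA -(verma_vir hM) addrC subrK. Qed.

Lemma chiA_whittaker n : rho%:Z <= n -> L n v0 = chiA C rho n *: v0.
Proof. by case: n => // n le; rewrite /= ifT // (verma_whittaker hM). Qed.

Lemma verma_spanned x : exists d : nat, Fil rho L v0 d%:Z x.
Proof.
have [s [a [hs ->]]] := verma_pbw_span hM x.
exists (\max_(t <- s) sumn t)%N.
rewrite [X in Fil _ _ _ _ X]big_seq; apply: Fil_sum => t ts; apply: FilZ.
have /andP[_ pt] := allP hs _ ts.
by apply: (@FilW _ _ _ _ _ _ t) => //; rewrite lez_nat; exact: leq_bigmax_seq.
Qed.

Lemma verma_v0_free (a : A) : a *: v0 = 0 -> a = 0.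
Proof.
move=> e; apply: (@verma_pbw_free _ _ _ _ _ hM [:: [::]] (fun=> a) _ _ _ [::]) => //.
by rewrite big_seq1.
Qed.

Definition LstarA (m : 'I_rho.+1) : {poly A} := Lstar_coef C (r := r) m.

(** Both sides unfold to the same convolutions; they differ only in pointwise versus functional
    equality. *)
Lemma irregular_solutionP nu g v : irregular_solution L v0 nu g v <->
  star_solution L LstarA (LambdaA C r) v0 (prefactor nu g) v.
Proof.
have e : (2 * r).-1 = (2 * rho).+1 by lia.
rewrite /irregular_solution /star_solution e.
split=> -[h0 h1 h2]; split=> //.
- by apply/funext => N; apply: h1.
- by move=> n hn; apply/funext => N; apply: h2.
- by move=> N; have := congr1 (fun f => f N) h1.
- by move=> n hn N; have := congr1 (fun f => f N) (h2 n hn).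
Qed.

Lemma irregular_vector :
  exists! s : A * {ffun 'I_r.-1 -> A} * (nat -> M),
    irregular_solution L v0 s.1.1 s.1.2 s.2.
Proof.
have nu := @coefA_nat_unit C rho.
have [[G v] [/= sG sol] uni] := irregular_series rho_gt0 vir_comm
  (@chiA_lt C rho rho_gt0) (@chiA_gt C rho rho_gt0) chiA_whittaker nu
  (@chiA_top_unit C rho rho_gt0) verma_spanned verma_v0_free
  (@LambdaA_chiA C rho rho_gt0) (@star_bracketA C r rho_gt0).
have [nu0 [g0 eG]] := prefactor_surj nu sG.
exists (nu0, g0, v); split=> /=; first by apply/irregular_solutionP; rewrite -eG.
(* Uniqueness of the polynomial passes to nu and g because [prefactor] is injective. *)
move=> [[nu1 g1] v1] /= /irregular_solutionP h1.
have [e ->] := uni _ _ (size_prefactor nu1 g1) h1.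
by move: e; rewrite eG => /(prefactor_inj nu)[-> ->].
Qed.

End Verma.

Theorem theorem4p4 (R : realType) (r : nat) (hr : (2 <= r)%N)
    (M : lmodType (coefA R[i] r)) (L : int -> {linear M -> M}%R) (v0 : M)
    (hM : irregular_verma L v0) :
  exists! s : coefA R[i] r * {ffun 'I_r.-1 -> coefA R[i] r} * (nat -> M),
    irregular_solution L v0 s.1.1 s.1.2 s.2.
Proof.
case: r hr M L v0 hM => [//|rho] hr M L v0 hM.
exact: (irregular_vector hr hM).
Qed.
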